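(* Let $K$ be a field, let $\mathbb{X}\subseteq\mathbb{P}^n_K$ be a $0$-dimensional locally Gorenstein scheme with no point of $\mathrm{Supp}(\mathbb{X})$ on the hyperplane $X_0=0$, let $0\le d\le r_{\mathbb{X}}-1$, and let $\sigma$ be a homogeneous trace map of degree zero of $Q^h(R)/L_0$. If for every $p_j\in\mathrm{Supp}(\mathbb{X})$ the maximal $p_j$-subscheme $\mathbb{Y}_j\subseteq\mathbb{X}$ satisfies $$x_0^d(I_{\mathbb{Y}_j/\mathbb{X}})_{r_{\mathbb{X}}}\nsubseteq(\delta^\sigma_{\mathbb{X}})_{r_{\mathbb{X}}+d},$$ then $\mathbb{X}$ has CBP($d$). In particular, if $\mathrm{HF}_{\delta^\sigma_{\mathbb{X}}}(r_{\mathbb{X}}+d)=0$, then $\mathbb{X}$ has CBP($d$).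
   Context: Setting. $P=K[X_0,\dots,X_n]$ has the standard grading, $I_{\mathbb{X}}\subseteq P$ is the (saturated) homogeneous vanishing ideal of $\mathbb{X}$, $R=P/I_{\mathbb{X}}$, and $\mathrm{Supp}(\mathbb{X})=\{p_1,\dots,p_s\}$ is the set of closed points. The residue class $x_0$ of $X_0$ in $R$ is a non-zerodivisor. $\mathcal{O}_{\mathbb{X},p_j}$ is the local ring at $p_j$, with residue field $\kappa(p_j)$; $\varkappa_j=\dim_K\kappa(p_j)$; $\deg(\mathbb{X})=\sum_j\dim_K\mathcal{O}_{\mathbb{X},p_j}$. For a graded module $M$, $\mathrm{HF}_M(i)=\dim_KM_i$; $\mathrm{HF}_{\mathbb{X}}=\mathrm{HF}_R$; $r_{\mathbb{X}}$ is the least integer such that $\mathrm{HF}_{\mathbb{X}}(i)=\deg(\mathbb{X})$ for all $i\ge r_{\mathbb{X}}$. $\mathbb{X}$ is locally Gorenstein if every $\mathcal{O}_{\mathbb{X},p_j}$ is a Gorenstein ring. $Q^h(R)$ is the localization of $R$ at all homogeneous non-zerodivisors; $Q^h(R)=R_{x_0}\cong\prod_{j=1}^s\mathcal{O}_{\mathbb{X},p_j}[T_j,T_j^{-1}]$ with $\deg T_j=1$, via the injection $\tilde\imath:R\to Q^h(R)$, $\tilde\imath(f)=(f_{p_1}T_1^i,\dots,f_{p_s}T_s^i)$ for $f\in R_i$, where $f_{p_j}$ is the germ of $f$ at $p_j$ (the image of $f/x_0^i$ in $\mathcal{O}_{\mathbb{X},p_j}$). Maximal subschemes and Cayley-Bacharach.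 A subscheme $\mathbb{Y}\subseteq\mathbb{X}$ is a $p_j$-subscheme if $\mathcal{O}_{\mathbb{Y},p_k}=\mathcal{O}_{\mathbb{X},p_k}$ for $k\ne j$ and $\mathcal{O}_{\mathbb{X},p_j}\to\mathcal{O}_{\mathbb{Y},p_j}$ is surjective; it is maximal if $\deg(\mathbb{Y})=\deg(\mathbb{X})-\varkappa_j$. Maximal $p_j$-subschemes correspond bijectively to the ideals $\langle s_j\rangle$ of $\mathcal{O}_{\mathbb{X},p_j}$ generated by a nonzero socle element $s_j$ (with $\mathcal{O}_{\mathbb{Y},p_j}=\mathcal{O}_{\mathbb{X},p_j}/\langle s_j\rangle$); for locally Gorenstein $\mathbb{X}$ there is exactly one for each $j$. $I_{\mathbb{Y}/\mathbb{X}}\subseteq R$ is the ideal of $\mathbb{Y}$ in $R$. For $a\in\mathcal{O}_{\mathbb{X},p_j}$ put $\mu(a)=\min\{i\in\mathbb{N}\mid(0,\dots,0,aT_j^i,0,\dots,0)\in\tilde\imath(R)\}$ (entry in position $j$). If $e_{j1},\dots,e_{j\varkappa_j}\in\mathcal{O}_{\mathbb{X},p_j}$ have residue classes forming a $K$-basis of $\kappa(p_j)$, put $\mu_{\mathbb{Y}/\mathbb{X}}=\max_k\mu(e_{jk}s_j)$ (independent of the choices). $\deg_{\mathbb{X}}(p_j)$ is the minimum of $\mu_{\mathbb{Y}/\mathbb{X}}$ over all maximal $p_j$-subschemes $\mathbb{Y}$. $\mathbb{X}$ has the Cayley-Bacharach property of degree $d$, CBP($d$), if $\deg_{\mathbb{X}}(p_j)\ge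 d+1$ for all $j$. Dedekind different. $L_0=K[x_0,x_0^{-1}]$. A homogeneous trace map of degree zero of $Q^h(R)/L_0$ is a homogeneous element $\sigma$ of degree $0$ of the graded module $\underline{\mathrm{Hom}}_{L_0}(Q^h(R),L_0)$ which is a $Q^h(R)$-basis of it; it exists when $\mathbb{X}$ is locally Gorenstein. The Dedekind complementary module $\mathfrak{C}^\sigma_{\mathbb{X}}\subseteq Q^h(R)$ is the image of the injection $\underline{\mathrm{Hom}}_{K[x_0]}(R,K[x_0])\to\underline{\mathrm{Hom}}_{L_0}(Q^h(R),L_0)=Q^h(R)\sigma\cong Q^h(R)$, $\varphi\mapsto\varphi\otimes\mathrm{id}_{L_0}$ (the last isomorphism sending $g\sigma$ to $g$). The Dedekind different is $\delta^\sigma_{\mathbb{X}}=\{f\in Q^h(R)\mid f\cdot\mathfrak{C}^\sigma_{\mathbb{X}}\subseteq R\}$, a homogeneous ideal of $R$. *)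

(* Defs.v *)
From HB Require Import structures.
From mathcomp Require Import all_boot all_order all_algebra.
From mathcomp Require Import generic_quotient.
From mathcomp Require Import boolp.
From mathcomp Require Import mpoly.
From mathcomp Require Import ring.

Set Implicit Arguments.
Unset Strict Implicit.
Unset Printing Implicit Defensive.
Import GRing.Theory.
Local Open Scope ring_scope.
Local Open Scope quotient_scope.

(* [natmin A] is 0 when A is empty. *)
Definition natmin (A : nat -> Prop) : nat :=
  if pselect (exists m, `[< A m >]) is left exA then ex_minn exA else 0%N.

Definition is_basis (K : fieldType) (V : lmodType K) (U : V -> Prop) (k : nat)
    (b : 'I_k -> V) : Prop :=
  (forall i, U (b i)) /\
  (forall v, U v -> exists! c : 'rV[K]_k, v = \sum_(i < k) c 0 i *: b i).

(* Intended for finite-dimensional subspaces U (the value is 0 otherwise). *)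
Definition dim (K : fieldType) (V : lmodType K) (U : V -> Prop) : nat :=
  natmin (fun k => exists b : 'I_k -> V, is_basis U b).

Record ideal_axiom (A : comNzRingType) (I : A -> Prop) : Prop := IdealAxiom {
  ideal0 : I 0;
  idealD : forall f g, I f -> I g -> I (f + g);
  idealM : forall a f, I f -> I (a * f) }.

(* Rings of fractions of A/I: a fraction system consists of an ideal I of A *)
(* and of the admissible pairs (numerator, denominator); f/g = f'/g' iff     *)
(* h (f g' - f' g) lies in I for some admissible denominator h.  One         *)
(* construction thus yields quotients A/I, localizations S^-1(A/I) and       *)
(* homogeneous localizations (A/I)_(p).                                      *)
Record fracsys (K : fieldType) (A : comAlgType K) := FracSys {
  fs_ideal : A -> Prop;
  fs_adm : A -> A -> Prop;
  fs_idealP : ideal_axiom fs_ideal;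
  fs_adm1 : fs_adm 1 1;
  fs_admZ : forall (c : K) f g, fs_adm f g -> fs_adm (c *: f) g;
  fs_admD : forall f g f' g', fs_adm f g -> fs_adm f' g' ->
    fs_adm (f * g' + f' * g) (g * g');
  fs_admM : forall f g f' g', fs_adm f g -> fs_adm f' g' ->
    fs_adm (f * f') (g * g') }.

Section Frac.
Variables (K : fieldType) (A : comAlgType K) (F : fracsys A).
Local Notation I := (fs_ideal F).
Local Notation adm := (fs_adm F).

Definition preFrac := {fg : A * A | `[< adm fg.1 fg.2 >]}.

Lemma preFrac_adm (x : preFrac) : adm (val x).1 (val x).2.
Proof. exact/asboolP/(valP x). Qed.

Definition frac_equiv (x y : preFrac) : bool :=
  `[< exists2 h, adm 0 h &
      I (h * ((val x).1 * (val y).2 - (val y).1 * (val x).2)) >].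

Lemma adm0 f g : adm f g -> adm 0 g.
Proof. by move/(fs_admZ 0); rewrite scale0r. Qed.

Lemma adm0M g g' : adm 0 g -> adm 0 g' -> adm 0 (g * g').
Proof. by move=> h h'; have := fs_admM h h'; rewrite mul0r. Qed.

Lemma frac_equiv_is_equiv : equiv_class_of frac_equiv.
Proof.
split=> [x|x y|y x z].
- apply/asboolP; exists 1; first exact: adm0 (fs_adm1 F).
  by rewrite subrr mulr0; exact: ideal0 (fs_idealP F).
- by apply/asboolP/asboolP => -[h ah hI]; exists h => //;
     rewrite -opprB mulrN -mulN1r; apply: idealM (fs_idealP F) _ _ hI.
- move=> /asboolP[h ah hI] /asboolP[k ak kI]; apply/asboolP.
  exists (h * k * (val y).2).
    by apply: adm0M; [exact: adm0M | exact: adm0 (preFrac_adm y)].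
  have -> : h * k * (val y).2 * ((val x).1 * (val z).2 - (val z).1 * (val x).2)
    = k * (val z).2 * (h * ((val x).1 * (val y).2 - (val y).1 * (val x).2))
    + h * (val x).2 * (k * ((val y).1 * (val z).2 - (val z).1 * (val y).2))
    by ring.
  by apply: (idealD (fs_idealP F)); apply: (idealM (fs_idealP F)).
Qed.

Canonical frac_equiv_equiv := EquivRelPack frac_equiv_is_equiv.
Canonical frac_equiv_encModRel := defaultEncModRel frac_equiv.

Definition frac := {eq_quot frac_equiv}.
HB.instance Definition _ := EqQuotient.on frac.
HB.instance Definition _ := Choice.on frac.

Definition preFrac1 : preFrac :=
  exist (fun fg : A * A => `[< adm fg.1 fg.2 >]) (1, 1) (asboolT (fs_adm1 F)).

(* The class of f/g; only meaningful for an admissible pair. *)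
Definition frac_of (f g : A) : frac := \pi_frac (insubd preFrac1 (f, g)).
Definition fnum (x : frac) : A := (val (repr x)).1.
Definition fden (x : frac) : A := (val (repr x)).2.

Lemma frac_adm x : adm (fnum x) (fden x).
Proof. exact: preFrac_adm. Qed.

Lemma frac_ofK x : frac_of (fnum x) (fden x) = x.
Proof.
rewrite -[RHS]reprK /frac_of; congr (\pi_frac _); apply: val_inj.
rewrite insubdK; first by rewrite /fnum /fden; case: (val _).
exact/asboolP/frac_adm.
Qed.

Lemma frac_ofP f g f' g' : adm f g -> adm f' g' ->
  (frac_of f g = frac_of f' g' <->
   exists2 h, adm 0 h & I (h * (f * g' - f' * g))).
Proof.
move=> a a'; have v : val (insubd preFrac1 (f, g)) = (f, g).
  by rewrite insubdK //; exact/asboolP.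
have v' : val (insubd preFrac1 (f', g')) = (f', g').
  by rewrite insubdK //; exact/asboolP.
split=> [/eqP|].
  by rewrite /frac_of eqmodE /= => /asboolP; rewrite v v'.
by move=> H; apply/eqP; rewrite /frac_of eqmodE /=; apply/asboolP; rewrite v v'.
Qed.

Lemma frac_repr f g : adm f g ->
  exists2 h, adm 0 h & I (h * (fnum (frac_of f g) * g - f * fden (frac_of f g))).
Proof. by move=> a; apply/frac_ofP; rewrite ?frac_ofK //; exact: frac_adm. Qed.

Definition fadd x y :=
  frac_of (fnum x * fden y + fnum y * fden x) (fden x * fden y).
Definition fmul x y := frac_of (fnum x * fnum y) (fden x * fden y).
Definition fscale (c : K) x := frac_of (c *: fnum x) (fden x).
Definition fopp x := fscale (-1) x.

Lemma frac_elim (P : frac -> Prop) :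
  (forall f g, adm f g -> P (frac_of f g)) -> forall x, P x.
Proof. by move=> H x; rewrite -(frac_ofK x); apply: H; exact: frac_adm. Qed.

Lemma faddE f g f' g' : adm f g -> adm f' g' ->
  fadd (frac_of f g) (frac_of f' g') = frac_of (f * g' + f' * g) (g * g').
Proof.
move=> a a'; apply/frac_ofP; try by apply: fs_admD; rewrite //; exact: frac_adm.
have [h ah hI] := frac_repr a; have [k ak kI] := frac_repr a'.
exists (h * k); first exact: adm0M.
move: (fnum (frac_of f g)) (fden (frac_of f g)) hI => u v hI.
move: (fnum (frac_of f' g')) (fden (frac_of f' g')) kI => u' v' kI.
have -> : h * k * ((u * v' + u' * v) * (g * g') - (f * g' + f' * g) * (v * v'))
   = k * v' * g' * (h * (u * g - f * v)) + h * v * g * (k * (u' * g' - f' * v'))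
   by ring.
by apply: (idealD (fs_idealP F)); apply: (idealM (fs_idealP F)).
Qed.

Lemma fmulE f g f' g' : adm f g -> adm f' g' ->
  fmul (frac_of f g) (frac_of f' g') = frac_of (f * f') (g * g').
Proof.
move=> a a'; apply/frac_ofP; try by apply: fs_admM; rewrite //; exact: frac_adm.
have [h ah hI] := frac_repr a; have [k ak kI] := frac_repr a'.
exists (h * k); first exact: adm0M.
move: (fnum (frac_of f g)) (fden (frac_of f g)) hI => u v hI.
move: (fnum (frac_of f' g')) (fden (frac_of f' g')) kI => u' v' kI.
have -> : h * k * (u * u' * (g * g') - f * f' * (v * v'))
   = k * u' * g' * (h * (u * g - f * v)) + h * v * f * (k * (u' * g' - f' * v'))
   by ring.
by apply: (idealD (fs_idealP F)); apply: (idealM (fs_idealP F)).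
Qed.

Lemma fscaleE c f g : adm f g -> fscale c (frac_of f g) = frac_of (c *: f) g.
Proof.
move=> a; apply/frac_ofP; try by apply: fs_admZ; rewrite //; exact: frac_adm.
have [h ah hI] := frac_repr a; exists h => //.
rewrite -!scalerAl -scalerBr -scalerAr -mulr_algl.
exact: (idealM (fs_idealP F)).
Qed.

Lemma frac_of_eq f g f' g' : adm f g -> adm f' g' -> f * g' = f' * g ->
  frac_of f g = frac_of f' g'.
Proof.
move=> a a' e; apply/frac_ofP => //; exists 1; first exact: adm0 (fs_adm1 F).
by rewrite e subrr mulr0; exact: ideal0 (fs_idealP F).
Qed.

Local Ltac adm_tac := first [ assumption | exact: fs_adm1
  | exact: adm0 (fs_adm1 F) | apply: fs_admD; adm_tac | apply: fs_admM; adm_tac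
  | apply: fs_admZ; adm_tac ].
Local Ltac frac_tac := rewrite -/(frac_of _ _);
  do ?[rewrite faddE; [|adm_tac|adm_tac] | rewrite fmulE; [|adm_tac|adm_tac]
     | rewrite fscaleE; [|adm_tac]];
  try (apply: frac_of_eq; [adm_tac|adm_tac|]).

Let zero := frac_of 0 1.
Let one := frac_of 1 1.

Lemma faddA : associative fadd.
Proof.
by elim/frac_elim=> f g a; elim/frac_elim=> f' g' a';
   elim/frac_elim=> f'' g'' a''; frac_tac; ring.
Qed.
Lemma faddC : commutative fadd.
Proof.
by elim/frac_elim=> f g a; elim/frac_elim=> f' g' a'; frac_tac; ring.
Qed.
Lemma fadd0 : left_id zero fadd.
Proof. by elim/frac_elim=> f g a; rewrite /zero; frac_tac; ring. Qed.
Lemma faddN : left_inverse zero fopp fadd.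
Proof.
by elim/frac_elim=> f g a; rewrite /zero /fopp; frac_tac; rewrite scaleN1r; ring.
Qed.
HB.instance Definition _ := GRing.isZmodule.Build frac faddA faddC fadd0 faddN.

Lemma fmulA : associative fmul.
Proof.
by elim/frac_elim=> f g a; elim/frac_elim=> f' g' a';
   elim/frac_elim=> f'' g'' a''; frac_tac; ring.
Qed.
Lemma fmulC : commutative fmul.
Proof.
by elim/frac_elim=> f g a; elim/frac_elim=> f' g' a'; frac_tac; ring.
Qed.
Lemma fmul1 : left_id one fmul.
Proof. by elim/frac_elim=> f g a; rewrite /one; frac_tac; ring. Qed.
Lemma fmulDl : left_distributive fmul fadd.
Proof.
by elim/frac_elim=> f g a; elim/frac_elim=> f' g' a';
   elim/frac_elim=> f'' g'' a''; frac_tac; ring.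
Qed.
(* frac is the zero ring when 1/1 = 0/1, hence only a comPzRingType. *)
HB.instance Definition _ :=
  GRing.Zmodule_isComPzRing.Build frac fmulA fmulC fmul1 fmulDl.

Lemma fscaleA c c' x : fscale c (fscale c' x) = fscale (c * c') x.
Proof. by elim/frac_elim: x => f g a; frac_tac; rewrite scalerA. Qed.
Lemma fscale1 : left_id 1 fscale.
Proof. by elim/frac_elim=> f g a; frac_tac; rewrite scale1r. Qed.
Lemma fscaleDr : right_distributive fscale +%R.
Proof.
move=> c; elim/frac_elim=> f g a; elim/frac_elim=> f' g' a'.
by rewrite /GRing.add /=; frac_tac; rewrite -!scalerAl -scalerDr -!scalerAl.
Qed.
Lemma fscaleDl x : {morph fscale^~ x : c c' / c + c'}.
Proof.
elim/frac_elim: x => f g a c c'; rewrite /= [in RHS]/GRing.add /=; frac_tac.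
by rewrite -!scalerAl -scalerDl -!scalerAl mulrA.
Qed.
HB.instance Definition _ := GRing.Zmodule_isLmodule.Build K frac
  fscaleA fscale1 fscaleDr fscaleDl.

End Frac.

Arguments frac_of {K A} F f g.

(* The canonical map f/g |-> f/g between two rings of fractions of A; it is   *)
(* used only when G has more admissible pairs and a larger ideal than F.      *)
Definition frac_map (K : fieldType) (A : comAlgType K) (F G : fracsys A)
  (x : frac F) : frac G := frac_of G (fnum x) (fden x).

Definition noetherian (A : comPzRingType) : Prop :=
  forall I : A -> Prop, I 0 -> (forall f g, I f -> I g -> I (f + g)) ->
    (forall a f, I f -> I (a * f)) ->
  exists (m : nat) (e : 'I_m -> A),
    forall f, I f <-> exists c : 'I_m -> A, f = \sum_i c i * e i.

Definition injective_module (A : comPzRingType) (E : lmodType A) : Prop :=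
  forall (M N : lmodType A) (u : {linear M -> N}) (f : {linear M -> E}),
    injective u -> exists h : {linear N -> E}, forall x, h (u x) = f x.

(* There is an exact sequence 0 -> A -> E 0 -> E 1 -> ... of A-modules with   *)
(* E i injective for all i and E i = 0 for i > m.                             *)
Definition finite_self_injective_dimension (A : comPzRingType) : Prop :=
  exists (m : nat) (E : nat -> lmodType A)
         (eps : {linear A^o -> E 0%N})
         (d : forall i, {linear E i -> E i.+1}),
    [/\ injective eps,
        forall y, d 0%N y = 0 <-> exists x, y = eps x,
        forall i y, d i.+1 y = 0 <-> exists x, y = d i x,
        forall i, injective_module (E i) &
        forall i (x : E i), (m < i)%N -> x = 0].

(* For a local ring A. *)
Definition gorenstein (A : comPzRingType) : Prop :=
  noetherian A /\ finite_self_injective_dimension A.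

Section Schemes.
Variables (K : fieldType) (n : nat).
Local Notation P := {mpoly K[n.+1]}.
Local Notation X0 := ('X_ord0 : P).

Record homogeneous_ideal_axiom (I : P -> Prop) : Prop := HomogeneousIdealAxiom {
  hideal : ideal_axiom I;
  hidealH : forall f i, I f -> I (pihomog mdeg i f) }.

(* A closed subscheme of P^n_K is given by its saturated homogeneous         *)
(* vanishing ideal; the ideal P corresponds to the empty subscheme.           *)
Record subscheme := Subscheme {
  vanishing_ideal :> P -> Prop;
  vanishing_idealP : homogeneous_ideal_axiom vanishing_ideal;
  vanishing_ideal_saturated : forall f,
    (exists k, forall m : 'X_{1..n.+1},
        mdeg m = k -> vanishing_ideal ('X_[m] * f)) -> vanishing_ideal f }.

Definition is_subscheme (Y X : subscheme) : Prop := forall f, X f -> Y f.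

(* The (not necessarily closed) points of P^n_K.                              *)
Record point := Point {
  point_ideal :> P -> Prop;
  point_idealP : homogeneous_ideal_axiom point_ideal;
  point_proper : ~ point_ideal 1;
  point_prime : forall f g, point_ideal (f * g) ->
    point_ideal f \/ point_ideal g;
  point_relevant : exists i : 'I_n.+1, ~ point_ideal 'X_i }.

Definition in_scheme (X : subscheme) (p : point) : Prop :=
  forall f, X f -> p f.

Definition specializes (p q : point) : Prop := forall f, p f -> q f.

Definition closed_point (X : subscheme) (p : point) : Prop :=
  in_scheme X p /\ (forall q, specializes p q -> specializes q p).

Definition zero_dimensional (X : subscheme) : Prop :=
  (exists p, in_scheme X p) /\
  (forall p q, in_scheme X p -> in_scheme X q -> specializes p q ->
     specializes q p).

Definition is_support (X : subscheme) (s : nat) (p : 'I_s -> point) : Prop :=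
  [/\ forall j, closed_point X (p j),
      forall j k, (forall f, p j f <-> p k f) -> j = k &
      forall q, closed_point X q -> exists j, forall f, p j f <-> q f].

Section CoordinateRing.
Variable I : P -> Prop.
Hypothesis II : homogeneous_ideal_axiom I.

Definition coord_adm (f g : P) : Prop := g = 1.

Lemma coord_admD f g f' g' : coord_adm f g -> coord_adm f' g' ->
  coord_adm (f * g' + f' * g) (g * g').
Proof. by rewrite /coord_adm => -> ->; rewrite mulr1. Qed.

Lemma coord_admM f g f' g' : coord_adm f g -> coord_adm f' g' ->
  coord_adm (f * f') (g * g').
Proof. by rewrite /coord_adm => -> ->; rewrite mulr1. Qed.

Definition coord_sys : fracsys P :=
  @FracSys K P I coord_adm (hideal II) erefl (fun _ _ _ h => h)
    coord_admD coord_admM.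

(* Denominators: homogeneous polynomials whose class in P/I is a             *)
(* non-zerodivisor.                                                           *)
Definition quot_adm (f g : P) : Prop :=
  (exists i, g \is i.-homog) /\ (forall h, I (g * h) -> I h).

Lemma quot_adm1 : quot_adm 1 1.
Proof.
by split; [exists 0%N; exact: dhomog1 | move=> h; rewrite mul1r].
Qed.

Lemma quot_admM f g f' g' : quot_adm f g -> quot_adm f' g' ->
  quot_adm (f * f') (g * g').
Proof.
move=> [[i gi] gI] [[j gj] gJ]; split; first by exists (i + j)%N; exact: dhomogM.
by move=> h; rewrite -mulrA => /gI/gJ.
Qed.

Definition quot_sys : fracsys P :=
  @FracSys K P I quot_adm (hideal II) quot_adm1 (fun _ _ _ h => h)
    quot_admM quot_admM.

(* Homogeneous fractions of degree 0 with denominator off p.                  *)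
Definition local_adm (p : point) (f g : P) : Prop :=
  (exists i, f \is i.-homog /\ g \is i.-homog) /\ ~ p g.

Section LocalAdm.
Variable p : point.

Lemma local_adm1 : local_adm p 1 1.
Proof.
split; first by exists 0%N; split; exact: dhomog1.
exact: point_proper.
Qed.

Lemma local_admZ (c : K) f g : local_adm p f g -> local_adm p (c *: f) g.
Proof.
by move=> [[i [fi gi]] pg]; split=> //; exists i; split=> //; exact: dhomogZ.
Qed.

Lemma local_admD f g f' g' : local_adm p f g -> local_adm p f' g' ->
  local_adm p (f * g' + f' * g) (g * g').
Proof.
move=> [[i [fi gi]] pg] [[j [fj gj]] pg']; split; last by case/point_prime.
exists (i + j)%N; split; last exact: dhomogM.
by apply: dhomogD; [exact: dhomogM | rewrite addnC; exact: dhomogM].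
Qed.

Lemma local_admM f g f' g' : local_adm p f g -> local_adm p f' g' ->
  local_adm p (f * f') (g * g').
Proof.
move=> [[i [fi gi]] pg] [[j [fj gj]] pg']; split; last by case/point_prime.
by exists (i + j)%N; split; exact: dhomogM.
Qed.

End LocalAdm.

Definition local_sys (p : point) : fracsys P :=
  @FracSys K P I (local_adm p) (hideal II) (local_adm1 p) (@local_admZ p)
    (@local_admD p) (@local_admM p).

End CoordinateRing.

Variable X : subscheme.

(* R = P/I_X *)
Definition coord_ring := frac (coord_sys (vanishing_idealP X)).
Definition class (f : P) : coord_ring := frac_of _ f 1.
Definition x0 : coord_ring := class X0.

(* Q^h(R) *)
Definition hquot := frac (quot_sys (vanishing_idealP X)).
Definition coord_to_hquot : coord_ring -> hquot := @frac_map _ _ _ _.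

(* O_{X,p}; it is the zero ring when p is not in X.                           *)
Definition local_ring (p : point) := frac (local_sys (vanishing_idealP X) p).

(* kappa(p) = O_{P^n,p} / p O_{P^n,p}                                        *)
Definition residue_field (p : point) := frac (local_sys (point_idealP p) p).
Definition residue (p : point) : local_ring p -> residue_field p :=
  @frac_map _ _ _ _.

(* z is homogeneous of degree e.  The disjunct z = 0 matters for R, where      *)
(* nothing else has negative degree.                                          *)
Definition hdeg (F : fracsys P) (e : int) (z : frac F) : Prop :=
  z = 0 \/ exists (k l : nat) (f g : P),
    [/\ f \is k.-homog, g \is l.-homog, fs_adm F f g,
        e = k%:Z - l%:Z & z = frac_of F f g].

(* M_e for a graded K-subspace M.                                             *)
Definition component (F : fracsys P) (M : frac F -> Prop) (e : int) (z : frac F)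
    : Prop :=
  M z /\ hdeg e z.

Definition HF (F : fracsys P) (M : frac F -> Prop) (e : int) : nat :=
  dim (component M e).

Definition HF_scheme (i : nat) : nat := HF (fun _ : coord_ring => True) i.

Definition locally_gorenstein (s : nat) (p : 'I_s -> point) : Prop :=
  forall j, gorenstein (local_ring (p j)).

(* The germ at p of the component of degree i of rho; the degree i part of    *)
(* itilde rho is (germ (p_1) i rho T_1^i, ..., germ (p_s) i rho T_s^i).       *)
Definition germ (p : point) (i : nat) (rho : coord_ring) : local_ring p :=
  frac_of _ (pihomog mdeg i (fnum rho)) (X0 ^+ i).

(* L-linear maps phi : A -> A with values in a subring L of A, A being one of *)
(* the graded rings R, Q^h(R).                                                *)
Definition is_hom (F : fracsys P) (L : frac F -> Prop) (phi : frac F -> frac F)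
    : Prop :=
  [/\ forall z, L (phi z),
      forall y z, phi (y + z) = phi y + phi z &
      forall l z, L l -> phi (l * z) = l * phi z].

Definition homogeneous_map (F : fracsys P) (e : int) (phi : frac F -> frac F)
    : Prop :=
  forall k z, hdeg k z -> hdeg (k + e) (phi z).

(* The elements of the graded Hom are the finite sums of homogeneous          *)
(* homomorphisms.                                                             *)
Definition graded_hom (F : fracsys P) (L : frac F -> Prop)
    (phi : frac F -> frac F) : Prop :=
  exists (m : nat) (e : 'I_m -> int) (psi : 'I_m -> frac F -> frac F),
    (forall t, is_hom L (psi t) /\ homogeneous_map (e t) (psi t)) /\
    (forall z, phi z = \sum_t psi t z).

Definition polyX0 (c : {poly K}) : P := \sum_(k < size c) c`_k *: X0 ^+ k.

(* K[x_0] as a subring of R, and L_0 = K[x_0, x_0^-1] as a subring of Q^h(R)  *)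
Definition Kx0 (z : coord_ring) : Prop := exists c, z = class (polyX0 c).
Definition L0 (z : hquot) : Prop :=
  exists c N, z = frac_of _ (polyX0 c) (X0 ^+ N).

Definition homogeneous_trace_map0 (sigma : hquot -> hquot) : Prop :=
  [/\ graded_hom L0 sigma,
      homogeneous_map 0 sigma &
      forall phi, graded_hom L0 phi ->
        exists! g : hquot, forall z, phi z = sigma (g * z)].

Definition over_x0 (rho : coord_ring) (N : nat) : hquot :=
  coord_to_hquot rho * frac_of _ 1 (X0 ^+ N).

(* g sigma = phi (x) id_{L_0} for some phi in the graded Hom_{K[x_0]}(R, K[x_0]) *)
Definition dedekind_compl (sigma : hquot -> hquot) (g : hquot) : Prop :=
  exists phi : coord_ring -> coord_ring, graded_hom Kx0 phi /\
    forall rho N, sigma (g * over_x0 rho N) = over_x0 (phi rho) N.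

Definition dedekind_different (sigma : hquot -> hquot) (f : hquot) : Prop :=
  forall g, dedekind_compl sigma g -> exists rho, f * g = coord_to_hquot rho.

End Schemes.

(* In this section p_1, ..., p_s is meant to enumerate Supp(X).               *)
Section CayleyBacharach.
Variables (K : fieldType) (n : nat).
Local Notation P := {mpoly K[n.+1]}.
Variables (s : nat) (p : 'I_s -> point K n).

(* The degree of a subscheme Y with Supp(Y) contained in {p_1, ..., p_s}.     *)
Definition degree (Y : subscheme K n) : nat :=
  \sum_j dim (fun _ : local_ring Y (p j) => True).

Definition residue_degree (j : 'I_s) : nat :=
  dim (fun _ : residue_field (p j) => True).

(* A natural number: HF_X(i) = 0 < deg(X) for i < 0 when X is not empty.      *)
Definition regularity_index (X : subscheme K n) (r : nat) : Prop :=
  (forall i, (r <= i)%N -> HF_scheme X i = degree X) /\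
  (forall r', (forall i, (r' <= i)%N -> HF_scheme X i = degree X) ->
     (r <= r')%N).

Definition local_map (X Y : subscheme K n) (q : point K n) :
  local_ring X q -> local_ring Y q := @frac_map _ _ _ _.

Definition is_p_subscheme (X : subscheme K n) (j : 'I_s) (Y : subscheme K n)
    : Prop :=
  [/\ is_subscheme Y X,
      forall k, k != j -> bijective (@local_map X Y (p k)) &
      forall y, exists x, @local_map X Y (p j) x = y].

Definition maximal_p_subscheme (X : subscheme K n) (j : 'I_s)
    (Y : subscheme K n) : Prop :=
  is_p_subscheme X j Y /\ (degree Y + residue_degree j)%N = degree X.

(* I_{Y/X}, as a subset of R = P/I_X                                          *)
Definition rel_ideal (X Y : subscheme K n) (rho : coord_ring X) : Prop :=
  exists f, Y f /\ rho = class X f.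

(* The i such that (0, ..., 0, a T_j^i, 0, ..., 0) is in the image of itilde,  *)
(* compared coefficientwise, are minimized.                                   *)
Definition mu (X : subscheme K n) (j : 'I_s) (a : local_ring X (p j)) : nat :=
  natmin (fun i => exists rho : coord_ring X,
    germ (p j) i rho = a /\
    (forall k l, ~ (k = j /\ l = i) -> germ (p k) l rho = 0)).

Definition in_socle (X : subscheme K n) (q : point K n) (a : local_ring X q)
    : Prop :=
  forall b : local_ring X q, residue b = 0 -> b * a = 0.

(* The values max_k mu(e_k s_j) over all admissible choices of the s_j and    *)
(* e_1, ..., e_kappa_j; all choices give the same value.                      *)
Definition is_mu_rel (X : subscheme K n) (j : 'I_s) (Y : subscheme K n)
    (m : nat) : Prop :=
  exists (sj : local_ring X (p j))
         (e : 'I_(residue_degree j) -> local_ring X (p j)),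
    [/\ sj <> 0, in_socle sj,
        forall a, @local_map X Y (p j) a = 0 <-> exists b, a = b * sj,
        is_basis (fun _ : residue_field (p j) => True)
                 (fun k => residue (e k)) &
        m = \max_(k < residue_degree j) mu (e k * sj)%R].

(* deg_X(p_j) is the minimum of mu_{Y/X} over all maximal p_j-subschemes Y.   *)
Definition point_degree (X : subscheme K n) (j : 'I_s) : nat :=
  natmin (fun m => exists Y, maximal_p_subscheme X j Y /\ is_mu_rel X j Y m).

Definition CBP (X : subscheme K n) (d : nat) : Prop :=
  forall j, (d + 1 <= point_degree X j)%N.

End CayleyBacharach.

(* Main.v *)
(** Write B for the product of the local rings O_j and V_i for the image of R_i
    in B under f |-> f / x_0^i; the V_i increase, V_i = B for i >= r, and the
    degree i part of Q^h(R) is B x_0^i.  The trace sigma is K-valued and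
    nondegenerate on B.  If CBP(d) fails at p_j, then V_d contains the ideal
    <t> of B generated by a nonzero socle element t of O_j.  Let g = b x_0^e
    lie in the complementary module and let a be in the socle ideal of O_j
    defining a maximal p_j-subscheme.  If e < -d, then sigma(b V_d) = 0, so
    sigma(b <t>) = 0, hence b t = 0 by nondegeneracy; so b is not a unit at
    p_j and a b = 0.  If e >= -d, then a x_0^(r+d) g has degree at least r and
    lies in R.  Hence a x_0^(r+d) is in the different, for every such a. *)
Require Import Defs.
From HB Require Import structures.
From mathcomp Require Import all_boot all_order all_algebra.
From mathcomp Require Import boolp mpoly ring zify.
From mathcomp Require classical_sets.
(* all_algebra exports other constants named dim and frac. *)
Import Defs.

Set Implicit Arguments.
Unset Strict Implicit.
Unset Printing Implicit Defensive.
Import GRing.Theory.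
Local Open Scope ring_scope.

(** * Subspaces given by predicates *)

Lemma natmin_ind (A : nat -> Prop) (Q : nat -> Prop) :
  (exists m, A m) -> (forall m, A m -> Q m) -> Q (natmin A).
Proof.
move=> exA AQ; rewrite /natmin; case: pselect => [e|ne].
  by case: ex_minnP => m /asboolP /AQ.
by case: ne; case: exA => m Am; exists m; apply/asboolP.
Qed.

Section LinearAlgebra.
Variable K : fieldType.

Section OneSpace.
Variable V : lmodType K.
Implicit Types U : V -> Prop.

Definition subspace U :=
  U 0 /\ forall (c : K) u v, U u -> U v -> U (c *: u + v).

Definition spans (k : nat) (e : 'I_k -> V) U :=
  forall v, U v -> exists c : 'rV[K]_k, v = \sum_i c 0 i *: e i.

Definition lin_indep (k : nat) (b : 'I_k -> V) :=
  forall c : 'rV[K]_k, \sum_i c 0 i *: b i = 0 -> c = 0.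

Definition findim U := exists k (e : 'I_k -> V), spans e U.

Lemma subspace_sum U (I : finType) (c : I -> K) (b : I -> V) :
  subspace U -> (forall i, U (b i)) -> U (\sum_i c i *: b i).
Proof.
move=> [U0 UD] Ub; apply: (big_ind U) => // [x y Ux Uy|i _].
  by rewrite -[x]scale1r; apply: UD.
by rewrite -[_ *: _]addr0; apply: UD.
Qed.

Lemma is_basisP U k (b : 'I_k -> V) : subspace U ->
  (is_basis U b <-> [/\ forall i, U (b i), lin_indep b & spans b U]).
Proof.
move=> sU; split=> [[Ub H]|[Ub fb sb]].
- split=> // [c c0|v /H [c [-> _]]]; last by exists c.
  have [c' [_ uc']] := H 0 sU.1.
  rewrite -(uc' c) // -(uc' 0) //.
  by rewrite big1 // => i _; rewrite mxE scale0r.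
- split=> // v /sb [c vE]; exists c; split=> // c' vE'.
  apply/eqP; rewrite -subr_eq0; apply/eqP; apply: fb.
  under eq_bigr => i _ do rewrite !mxE scalerBl.
  by rewrite sumrB -vE -vE' subrr.
Qed.

Lemma lin_indep_leq U k l (e : 'I_k -> V) (b : 'I_l -> V) :
  spans e U -> (forall i, U (b i)) -> lin_indep b -> (l <= k)%N.
Proof.
move=> se Ub fb.
have /choice [M ME] : forall i, exists c : 'rV[K]_k, b i = \sum_j c 0 j *: e j.
  by move=> i; exact: se.
pose A : 'M[K]_(l, k) := \matrix_(i, j) M i 0 j.
have : row_free A.
  apply/row_freeP; have : kermx A = 0.
    apply/row_matrixP => i; rewrite row0; apply: fb.
    have kA : row i (kermx A) *m A = 0.
      by apply/sub_kermxP; rewrite row_sub.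
    under eq_bigr => j _ do rewrite ME scaler_sumr.
    rewrite exchange_big /= big1 // => j _.
    under eq_bigr => t _ do rewrite scalerA.
    rewrite -scaler_suml.
    have /matrixP /(_ 0 j) := kA; rewrite !mxE => k0.
    rewrite (eq_bigr (fun t => row i (kermx A) 0 t * A t j)) ?k0 ?scale0r //.
    by move=> t _; rewrite [A _ _]mxE.
  by move/eqP; rewrite kermx_eq0 => /row_freeP.
by rewrite /row_free => /eqP <-; apply: rank_leq_col.
Qed.

Definition extend (k : nat) (b : 'I_k -> V) (v : V) (i : 'I_k.+1) : V :=
  if unlift ord_max i is Some j then b j else v.

Lemma sum_extend k (b : 'I_k -> V) v (c : 'I_k.+1 -> K) :
  \sum_i c i *: extend b v i =
  \sum_(i < k) c (lift ord_max i) *: b i + c ord_max *: v.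
Proof.
rewrite big_ord_recr /= /extend unlift_none; congr (_ + _).
apply: eq_bigr => i _; suff -> : widen_ord (leqnSn k) i = lift ord_max i.
  by rewrite liftK.
by apply: val_inj; rewrite /= /bump leqNgt ltn_ord.
Qed.

Lemma lin_indep_extend k (b : 'I_k -> V) v : lin_indep b ->
  ~ (exists c : 'rV[K]_k, v = \sum_i c 0 i *: b i) -> lin_indep (extend b v).
Proof.
move=> fb nv c; rewrite (sum_extend b v (fun i => c 0 i)) => c0.
have cm : c 0 ord_max = 0.
  apply/eqP/negP => /negP cN0; apply: nv.
  exists (\row_i (- (c 0 ord_max)^-1 * c 0 (lift ord_max i))).
  under eq_bigr => i _ do rewrite mxE -scalerA.
  move/eqP: c0; rewrite -scaler_sumr addrC addr_eq0 => /eqP.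
  move/(congr1 (fun w => (c 0 ord_max)^-1 *: w)).
  by rewrite scalerA mulVf // scale1r => ->; rewrite scalerN scaleNr.
have c' : \row_i c 0 (lift ord_max i) = 0.
  apply: fb; move: c0; rewrite cm scale0r addr0 => c0.
  by rewrite -[RHS]c0; apply: eq_bigr => i _; rewrite mxE.
apply/rowP => i; rewrite mxE; case: (unliftP ord_max i) => [j ->|-> //].
by move/rowP: c' => /(_ j); rewrite !mxE.
Qed.

Lemma ex_basis U k (e : 'I_k -> V) : subspace U -> spans e U ->
  exists l (b : 'I_l -> V), is_basis U b.
Proof.
move=> sU se.
pose Q l := `[< exists b : 'I_l -> V, (forall i, U (b i)) /\ lin_indep b >].
have Q0 : exists l, Q l.
  exists 0%N; apply/asboolP; exists (fun=> 0); split=> [[]//|c _].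
  by apply/rowP => -[].
have Qk l : Q l -> (l <= k)%N.
  by move/asboolP => [b [Ub fb]]; exact: lin_indep_leq se Ub fb.
case: (ex_maxnP Q0 Qk) => l /asboolP [b [Ub fb]] lmax.
exists l, b; apply/is_basisP => //; split=> // v Uv.
apply: contrapT => nv; have /lmax : Q l.+1; last by rewrite ltnn.
apply/asboolP; exists (extend b v); split; last exact: lin_indep_extend.
by move=> i; rewrite /extend; case: unlift.
Qed.

Lemma is_basis_dim U k (b : 'I_k -> V) : subspace U -> is_basis U b -> dim U = k.
Proof.
move=> sU bU; apply: (natmin_ind (Q := fun m => m = k)); first by exists k, b.
move=> m [b' /(is_basisP _ sU)[Ub' fb' sb']].
have [Ub fb sb] := (is_basisP _ sU).1 bU.
by apply/eqP; rewrite eqn_leq (lin_indep_leq sb Ub' fb') (lin_indep_leq sb' Ub fb).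
Qed.

Lemma dim_basis U : subspace U -> findim U ->
  exists b : 'I_(dim U) -> V, is_basis U b.
Proof.
move=> sU [k [e se]]; have [l [b bU]] := ex_basis sU se.
by rewrite (is_basis_dim sU bU); exists b.
Qed.

Lemma findim_sub U U' : (forall v, U v -> U' v) -> findim U' -> findim U.
Proof. by move=> sub [k [e se]]; exists k, e => v /sub /se. Qed.

Lemma dim_leq U U' : subspace U -> subspace U' -> findim U' ->
  (forall v, U v -> U' v) -> (dim U <= dim U')%N.
Proof.
move=> sU sU' fU' sub.
have [b' /(is_basisP _ sU')[_ _ sb']] := dim_basis sU' fU'.
have [b /(is_basisP _ sU)[Ub fb _]] := dim_basis sU (findim_sub sub fU').
by apply: lin_indep_leq sb' _ fb => i; apply: sub.
Qed.

Lemma dim_leq_eq U U' : subspace U -> subspace U' -> findim U' ->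
  (forall v, U v -> U' v) -> (dim U' <= dim U)%N -> forall v, U' v -> U v.
Proof.
move=> sU sU' fU' sub leUU' v U'v.
have [b' /(is_basisP _ sU')[_ _ sb']] := dim_basis sU' fU'.
have [b /(is_basisP _ sU)[Ub fb sb]] := dim_basis sU (findim_sub sub fU').
apply: contrapT => nUv.
suff /(lin_indep_leq sb') : lin_indep (extend b v).
  rewrite ltnNge leUU' => /(_ _) H; suff: false by []; apply: H.
  by move=> i; rewrite /extend; case: unlift => // j; apply: sub.
apply: lin_indep_extend => // -[c vE]; apply: nUv; rewrite vE.
exact: subspace_sum.
Qed.

Lemma dim_eq0 U : subspace U -> findim U -> dim U = 0%N -> forall v, U v -> v = 0.
Proof.
move=> sU fU d0 v Uv; have [b bU] := dim_basis sU fU.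
have [_ _ /(_ v Uv) [c ->]] := (is_basisP _ sU).1 bU.
by apply: big1 => -[i ilt] _; exfalso; move: ilt; rewrite d0.
Qed.

Lemma dim_gt0 U v : subspace U -> findim U -> U v -> v <> 0 -> (0 < dim U)%N.
Proof.
move=> sU fU Uv v0; rewrite lt0n; apply/eqP => /(dim_eq0 sU fU) /(_ v Uv).
exact: v0.
Qed.

Lemma exists_nonzero U : subspace U -> findim U -> (0 < dim U)%N ->
  exists2 u, U u & u <> 0.
Proof.
move=> sU fU; have [b /(is_basisP _ sU) [Ub fb _]] := dim_basis sU fU.
move: (dim U) b Ub fb => [//|k] b Ub fb _; exists (b ord0) => // b0.
have := fb (delta_mx 0 ord0).
rewrite (bigD1 ord0) //= b0 scaler0 add0r big1 => [/(_ erefl)|i i0].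
  by move/rowP/(_ ord0); rewrite !mxE !eqxx => /eqP; rewrite oner_eq0.
by rewrite mxE eqxx (negPf i0) scale0r.
Qed.

Lemma eq_dim U U' :
  (forall v, U v <-> U' v) -> dim U = dim U'.
Proof. by move=> e; congr dim; apply/funext => v; apply/propext. Qed.

End OneSpace.

Section LinearMap.
Variables (V W : lmodType K) (phi : V -> W).
Hypothesis phi_lin : forall (c : K) u v, phi (c *: u + v) = c *: phi u + phi v.

Definition lin_image (U : V -> Prop) (w : W) := exists2 u, U u & phi u = w.
Definition lin_kernel (U : V -> Prop) (u : V) := U u /\ phi u = 0.

Let phi_0 : phi 0 = 0.
Proof. by have := phi_lin (-1) 0 0; rewrite scaler0 add0r scaleN1r addNr. Qed.

Lemma lin_map_sum (I : finType) (c : I -> K) (b : I -> V) :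
  phi (\sum_i c i *: b i) = \sum_i c i *: phi (b i).
Proof.
by elim/big_rec2: _ => // i w v _ <-; rewrite phi_lin.
Qed.

Lemma subspace_image U : subspace U -> subspace (lin_image U).
Proof.
move=> [U0 UD]; split; first by exists 0.
by move=> c _ _ [u Uu <-] [v Uv <-]; exists (c *: u + v); rewrite ?phi_lin //; apply: UD.
Qed.

Lemma findim_image U : findim U -> findim (lin_image U).
Proof.
move=> [k [e se]]; exists k, (phi \o e) => _ [u /se [c ->] <-].
by exists c; rewrite lin_map_sum.
Qed.

Lemma subspace_kernel U : subspace U -> subspace (lin_kernel U).
Proof.
move=> [U0 UD]; split=> // c u v [Uu u0] [Uv v0]; split; first exact: UD.
by rewrite phi_lin u0 v0 scaler0 addr0.
Qed.

Lemma rank_nullity U : subspace U -> findim U ->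
  dim U = (dim (lin_kernel U) + dim (lin_image U))%N.
Proof.
move=> sU fU; have [U0 UD] := sU.
have sK := subspace_kernel sU; have sI := subspace_image sU.
have [b bK] := dim_basis sK (findim_sub (fun v (h : lin_kernel U v) => h.1) fU).
have [w bI] := dim_basis sI (findim_image fU).
move: (dim (lin_kernel U)) b bK (dim (lin_image U)) w bI => k b bK l w bI.
have [Kb fb sb] := (is_basisP _ sK).1 bK.
have [Iw fw sw] := (is_basisP _ sI).1 bI.
have /choice [a aE] : forall i, exists u, U u /\ phi u = w i.
  by move=> i; have [u] := Iw i; exists u.
pose x (i : 'I_(k + l)) := match split i with inl j => b j | inr j => a j end.
have xl i : x (lshift l i) = b i by rewrite /x -[lshift _ _]/(unsplit (inl i)) unsplitK.
have xr i : x (rshift k i) = a i by rewrite /x -[rshift _ _]/(unsplit (inr i)) unsplitK.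
have sumE (c : 'I_(k + l) -> K) : \sum_i c i *: x i =
    \sum_i c (lshift l i) *: b i + \sum_i c (rshift k i) *: a i.
  by rewrite big_split_ord; congr (_ + _); apply: eq_bigr => i _; rewrite ?xl ?xr.
apply: (is_basis_dim sU (b := x)); apply/is_basisP => //; split.
- by move=> i; rewrite /x; case: split => j; [case: (Kb j)|case: (aE j)].
- move=> c; rewrite (sumE (fun i => c 0 i)) => c0.
  have cr : rsubmx c = 0.
    apply: fw; move/(congr1 phi): c0; rewrite phi_0.
    rewrite -[X in phi (X + _)]scale1r phi_lin !lin_map_sum big1 => [|i _].
      rewrite scaler0 add0r; apply: etrans; apply: eq_bigr => i _.
      by rewrite mxE (aE i).2.
    by rewrite (Kb i).2 scaler0.
  have cl : lsubmx c = 0.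
    apply: fb; move: c0; rewrite [X in _ + X]big1 ?addr0.
      by apply: etrans; apply: eq_bigr => i _; rewrite mxE.
    by move=> i _; move/rowP: cr => /(_ i); rewrite !mxE => ->; rewrite scale0r.
  by rewrite -[c]hsubmxK cl cr row_mx0.
- move=> v Uv; have [c vE] := sw (phi v) (ex_intro2 _ _ v Uv erefl).
  pose v' := \sum_i c 0 i *: a i.
  have Uv' : U v' by apply: subspace_sum => // i; case: (aE i).
  have [] := sb (- 1 *: v' + v).
    split; first exact: UD.
    rewrite phi_lin lin_map_sum vE; under eq_bigr => i _ do rewrite (aE i).2.
    by rewrite scaleN1r addNr.
  move=> c' c'E; exists (row_mx c' c); rewrite (sumE (fun i => row_mx c' c 0 i)).
  under eq_bigr => i _ do rewrite row_mxEl.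
  under [X in _ = _ + X]eq_bigr => i _ do rewrite row_mxEr.
  by rewrite -c'E -/v' scaleN1r addrAC addNr add0r.
Qed.

Lemma dim_image_inj U : subspace U -> findim U ->
  (forall u, U u -> phi u = 0 -> u = 0) -> dim (lin_image U) = dim U.
Proof.
move=> sU fU inj; rewrite (rank_nullity sU fU).
suff -> : dim (lin_kernel U) = 0%N by [].
apply: (is_basis_dim (subspace_kernel sU) (b := fun i : 'I_0 => 0)).
apply/is_basisP; first exact: subspace_kernel.
split=> [[]//|c _|v [Uv v0]]; first by apply/rowP => -[].
by exists 0; rewrite big_ord0; apply: inj.
Qed.

Lemma dim_image_surj : (forall w, exists u, phi u = w) ->
  dim (lin_image (fun _ => True)) = dim (fun _ : W => True).
Proof.
by move=> surj; apply: eq_dim => w; split=> // _; have [u] := surj w; exists u.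
Qed.

End LinearMap.

Lemma subspaceT (V : lmodType K) : subspace (fun _ : V => True).
Proof. by []. Qed.

Lemma eq_kernel_dim_image (V W W' : lmodType K) (phi : V -> W) (psi : V -> W')
    (U : V -> Prop) :
  (forall (c : K) u v, phi (c *: u + v) = c *: phi u + phi v) ->
  (forall (c : K) u v, psi (c *: u + v) = c *: psi u + psi v) ->
  subspace U -> findim U -> (forall u, phi u = 0 <-> psi u = 0) ->
  dim (lin_image phi U) = dim (lin_image psi U).
Proof.
move=> lphi lpsi sU fU eqk; have := rank_nullity lphi sU fU.
rewrite (rank_nullity lpsi sU fU) (@eq_dim _ (lin_kernel psi U) (lin_kernel phi U)).
  by move/addnI.
by move=> v; rewrite /lin_kernel eqk.
Qed.

Lemma joint_surjective (V : lmodType K) (s : nat) (W : 'I_s -> lmodType K)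
    (phi : forall j, V -> W j) (U : V -> Prop) :
  (forall j (c : K) u v, phi j (c *: u + v) = c *: phi j u + phi j v) ->
  subspace U -> findim U ->
  (forall j, findim (fun _ : W j => True)) ->
  (forall u, U u -> (forall j, phi j u = 0) -> u = 0) ->
  (dim U >= \sum_j dim (fun _ : W j => True))%N ->
  forall j (w : W j), exists u, [/\ U u, phi j u = w &
    forall k, k != j -> phi k u = 0].
Proof.
move=> phi_lin sU fU fW inj dimU j.
pose Z (t : seq 'I_s) u := U u /\ forall k, k \in t -> phi k u = 0.
have fZ t : findim (Z t) by apply: findim_sub fU => v [].
have sZ t : subspace (Z t).
  have phi_0 k : phi k 0 = 0.
    by have := phi_lin k (-1) 0 0; rewrite scaler0 add0r scaleN1r addNr.
  split; first by split=> //; exact: sU.1.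
  move=> c u v [Uu u0] [Uv v0]; split; first exact: sU.2.
  by move=> k kt; rewrite phi_lin u0 // v0 // scaler0 addr0.
have dimZ t : (dim U <= dim (Z t) + \sum_(k <- t) dim (fun _ : W k => True))%N.
  elim: t => [|k t IH].
    by rewrite big_nil addn0; apply: dim_leq.
  apply: leq_trans IH _; rewrite big_cons addnA leq_add2r.
  rewrite (rank_nullity (phi_lin k) (sZ t) (fZ t)); apply: leq_add.
    apply: dim_leq => //; first exact: subspace_kernel.
    move=> v [[Uv v0] vk]; split=> // i; rewrite in_cons => /orP[/eqP -> //|].
    exact: v0.
  by apply: dim_leq => //; apply: subspace_image.
pose t := [seq k <- enum 'I_s | k != j].
have dimZj : (dim (fun _ : W j => True) <= dim (Z t))%N.
  rewrite -(leq_add2r (\sum_(k <- t) dim (fun _ : W k => True))).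
  apply: leq_trans (dimZ t); apply: leq_trans dimU.
  by rewrite big_filter big_enum_cond /= [X in (_ <= X)%N](bigD1 j).
have injZ u : Z t u -> phi j u = 0 -> u = 0.
  move=> [Uu u0] uj; apply: inj => // k.
  have [-> //|kj] := eqVneq k j.
  by apply: u0; rewrite mem_filter kj mem_enum.
move=> w; have [u [Uu u0] uw] : lin_image (phi j) (Z t) w.
  apply: (dim_leq_eq _ (@subspaceT _)) => //.
    exact: subspace_image.
  by rewrite (dim_image_inj (phi_lin j)).
by exists u; split=> // k kj; apply: u0; rewrite mem_filter kj mem_enum.
Qed.

End LinearAlgebra.

(** * Rings of fractions *)

Section FracTheory.
Variables (K : fieldType) (A : comAlgType K) (F : fracsys A).
Local Notation I := (fs_ideal F).
Local Notation adm := (fs_adm F).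

Lemma frac0E : (0 : frac F) = frac_of F 0 1. Proof. by []. Qed.

Lemma frac_ofD f g f' g' : adm f g -> adm f' g' ->
  frac_of F f g + frac_of F f' g' = frac_of F (f * g' + f' * g) (g * g').
Proof. exact: faddE. Qed.

Lemma frac_ofM f g f' g' : adm f g -> adm f' g' ->
  frac_of F f g * frac_of F f' g' = frac_of F (f * f') (g * g').
Proof. exact: fmulE. Qed.

Lemma frac_ofZ (c : K) f g : adm f g -> c *: frac_of F f g = frac_of F (c *: f) g.
Proof. exact: fscaleE. Qed.

Lemma adm01 : adm 0 1.
Proof. exact: adm0 (fs_adm1 F). Qed.

Lemma frac_of0 g : adm 0 g -> frac_of F 0 g = 0.
Proof.
move=> a; apply: frac_of_eq => //; first exact: adm01.
by rewrite !mul0r.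
Qed.

Lemma frac_of_eq0 f g : adm f g ->
  frac_of F f g = 0 <-> exists2 h, adm 0 h & I (h * f).
Proof.
move=> a; rewrite frac0E; split.
  move/frac_ofP => -[//||h ah]; first exact: adm01.
  by rewrite mulr1 mul0r subr0; exists h.
move=> [h ah hI]; apply/frac_ofP => //; first exact: adm01.
by exists h => //; rewrite mulr1 mul0r subr0.
Qed.

Lemma frac_scaleAl (c : K) (x y : frac F) : c *: (x * y) = (c *: x) * y.
Proof.
elim/frac_elim: x => f g a; elim/frac_elim: y => f' g' a'.
rewrite frac_ofM // !frac_ofZ ?frac_ofM //; last exact: fs_admM.
  by rewrite scalerAl.
exact: fs_admZ.
Qed.

Lemma frac_scaleAr (c : K) (x y : frac F) : c *: (x * y) = x * (c *: y).
Proof. by rewrite mulrC frac_scaleAl mulrC. Qed.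

Lemma frac_mulr_lin (a : frac F) (c : K) (u v : frac F) :
  (c *: u + v) * a = c *: (u * a) + v * a.
Proof. by rewrite mulrDl frac_scaleAl. Qed.

Lemma frac_mull_lin (a : frac F) (c : K) (u v : frac F) :
  a * (c *: u + v) = c *: (a * u) + a * v.
Proof. by rewrite mulrDr frac_scaleAr. Qed.

End FracTheory.

Section FracMap.
Variables (K : fieldType) (A : comAlgType K) (F G : fracsys A).
Hypothesis admFG : forall f g, fs_adm F f g -> fs_adm G f g.
Hypothesis idealFG : forall f, fs_ideal F f -> fs_ideal G f.
Local Notation fm := (@frac_map K A F G).

Lemma frac_map_of f g : fs_adm F f g -> fm (frac_of F f g) = frac_of G f g.
Proof.
move=> a; have [h ah hI] := frac_repr a.
apply/frac_ofP; [exact/admFG/frac_adm|exact: admFG|].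
by exists h; [exact: admFG|exact: idealFG].
Qed.

Lemma frac_mapM x y : fm (x * y) = fm x * fm y.
Proof.
elim/frac_elim: x => f g a; elim/frac_elim: y => f' g' a'.
by rewrite frac_ofM // !frac_map_of ?frac_ofM //;
  [exact: admFG|exact: admFG|exact: fs_admM].
Qed.

Lemma frac_mapP (c : K) x y : fm (c *: x + y) = c *: fm x + fm y.
Proof.
elim/frac_elim: x => f g a; elim/frac_elim: y => f' g' a'.
have aZ := fs_admZ c a.
rewrite frac_ofZ // frac_ofD // !frac_map_of //; last exact: fs_admD.
by rewrite frac_ofZ ?frac_ofD //; apply: admFG.
Qed.

Lemma frac_map0 : fm 0 = 0.
Proof. by rewrite frac0E frac_map_of //; exact: adm01. Qed.

Lemma frac_map_surj : (forall f g, fs_adm G f g -> fs_adm F f g) ->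
  forall y, exists x, fm x = y.
Proof.
move=> admGF; elim/frac_elim=> f g a; exists (frac_of F f g).
by rewrite frac_map_of //; apply: admGF.
Qed.

End FracMap.

Section GradedPolynomials.
Variables (K : fieldType) (n : nat).
Local Notation P := {mpoly K[n.+1]}.
Local Notation X0 := ('X_ord0 : P).
Local Notation pi := (@pihomog n.+1 K mdeg).
Implicit Types f g : P.

Lemma mpoly_sum_homog f : exists N, f = \sum_(d < N) pi d f.
Proof. by exists (mmeasure mdeg f); apply: pihomog_partitionE. Qed.

Lemma dhomogX0 k : X0 ^+ k \is k.-homog.
Proof.
have : X0 \is 1.-homog by rewrite dhomogX; apply/eqP; exact: mdeg1.
by move/(dhomogMn k); rewrite mul1n.
Qed.

Lemma pihomogM_homog k d f g : f \is k.-homog ->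
  pi d (f * g) = if (k <= d)%N then f * pi (d - k) g else 0.
Proof.
move=> fk; have [N gE] := mpoly_sum_homog g.
rewrite {1}gE mulr_sumr linear_sum /=.
have piE (i : 'I_N) : pi d (f * pi i g) = if (k + i)%N == d then f * pi i g else 0.
  have h : f * pi i g \is (k + i).-homog by apply: dhomogM => //; apply: pihomogP.
  by case: eqP => [<-|/eqP ne]; [rewrite pihomog_dE|rewrite (pihomog_ne0 ne)].
under eq_bigr do rewrite piE.
case: leqP => kd; last first.
  by rewrite big1 // => i _; case: eqP => // e; move: kd; rewrite -e ltnNge leq_addr.
rewrite -big_mkcond /= -mulr_sumr; congr (_ * _).
rewrite {2}gE linear_sum /= [RHS](bigID (fun i : 'I_N => (k + i)%N == d)) /=.
rewrite [X in _ = _ + X]big1 ?addr0; last first.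
  move=> i ne; apply: pihomog_ne0 (pihomogP _ _ _).
  by apply: contraNneq ne => ->; rewrite subnKC.
apply: eq_bigr => i /eqP e; rewrite -e addKn pihomog_id //.
Qed.

Lemma pihomogM_homogD k d f g : f \is k.-homog -> pi (k + d) (f * g) = f * pi d g.
Proof. by move=> fk; rewrite (pihomogM_homog _ _ fk) leq_addr addKn. Qed.

Lemma pihomogM d f g : pi d (f * g) = \sum_(k < d.+1) pi k f * pi (d - k) g.
Proof.
have le : (d.+1 <= maxn (mmeasure mdeg f) d.+1)%N by apply: leq_maxr.
rewrite {1}(pihomog_partitionE (leq_maxl _ d.+1 : (mmeasure mdeg f <= _)%N)).
rewrite mulr_suml linear_sum /=.
under eq_bigr => k _ do rewrite (pihomogM_homog d g (pihomogP _ k f)) -ltnS.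
by rewrite -big_mkcond /= (big_ord_narrow le).
Qed.

Lemma homog_spans d : exists k (e : 'I_k -> P), forall f, f \is d.-homog ->
  exists c : 'rV[K]_k, f = \sum_i c 0 i *: e i.
Proof.
pose T : finType := 'X_{1..n.+1 < d.+1}.
exists #|T|, (fun i => 'X_[bmnm (enum_val i)]) => f fd.
exists (\row_i f@_(bmnm (enum_val i))).
have sf : (msize f <= d.+1)%N.
  have [->|f0] := eqVneq f 0; first by rewrite msize0.
  move: (dhomog_msize fd) => h.
  have := dhomog_uniq f0 fd h; rewrite -[mmeasure _ _]/(msize f) => e.
  by rewrite e -ltnS prednK // lt0n mmeasure_poly_eq0.
rewrite {1}(mpolywE sf) (reindex (@enum_val T T)) /=; last first.
  by exists enum_rank => i _; [exact: enum_valK|exact: enum_rankK].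
by apply: eq_bigr => i _; rewrite mxE.
Qed.

End GradedPolynomials.

(** * Homogeneous ideals and points *)

Section HomogeneousIdeals.
Variables (K : fieldType) (n : nat).
Local Notation P := {mpoly K[n.+1]}.
Local Notation X0 := ('X_ord0 : P).
Local Notation pi := (@pihomog n.+1 K mdeg).

Lemma hideal0 (I : P -> Prop) : homogeneous_ideal_axiom I -> I 0.
Proof. by case=> /ideal0. Qed.

Lemma hidealD (I : P -> Prop) f g : homogeneous_ideal_axiom I -> I f -> I g -> I (f + g).
Proof. by case=> /idealD H _; exact: H. Qed.

Lemma hidealMl (I : P -> Prop) a f : homogeneous_ideal_axiom I -> I f -> I (a * f).
Proof. by case=> /idealM H _; exact: H. Qed.

Lemma hidealMr (I : P -> Prop) a f : homogeneous_ideal_axiom I -> I f -> I (f * a).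
Proof. by rewrite mulrC; exact: hidealMl. Qed.

Lemma hidealN (I : P -> Prop) f : homogeneous_ideal_axiom I -> I f -> I (- f).
Proof. by rewrite -mulN1r; exact: hidealMl. Qed.

Lemma hidealB (I : P -> Prop) f g : homogeneous_ideal_axiom I -> I f -> I g -> I (f - g).
Proof. by move=> hI If Ig; apply: hidealD => //; apply: hidealN. Qed.

Lemma hideal_sum (I : P -> Prop) (J : Type) (r : seq J) (Q : pred J) (f : J -> P) :
  homogeneous_ideal_axiom I -> (forall i, Q i -> I (f i)) ->
  I (\sum_(i <- r | Q i) f i).
Proof.
move=> hI If; apply: (big_ind I) => //; first exact: hideal0.
by move=> x y; exact: hidealD.
Qed.

Lemma hideal_components (I : P -> Prop) f : homogeneous_ideal_axiom I ->
  (forall d, I (pi d f)) -> I f.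
Proof.
move=> hI If; have [N ->] := mpoly_sum_homog f.
by apply: hideal_sum.
Qed.

Lemma no_variable_nilpotent (J : P -> Prop) : homogeneous_ideal_axiom J ->
  (forall k, exists2 m : 'X_{1..n.+1}, mdeg m = k & ~ J 'X_[m]) ->
  exists i, forall N, ~ J ('X_i ^+ N).
Proof.
move=> hJ nJ; apply: contrapT => H.
have /choice [N JN] : forall i : 'I_n.+1, exists N, J ('X_i ^+ N).
  move=> i; apply: contrapT => ni; apply: H; exists i => N JN.
  by apply: ni; exists N.
have [m mE []] := nJ (\sum_i N i)%N.
have [i leNm] : exists i, (N i <= m i)%N.
  apply: contrapT => ni; have lt i : (m i < N i)%N.
    by rewrite ltnNge; apply/negP => le; apply: ni; exists i.
  move: mE; rewrite mdegE => /eqP; apply/negP; rewrite neq_ltn.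
  rewrite (bigD1 ord0) //= [X in (_ < X)%N](bigD1 ord0) //= -addSn leq_add //.
  by apply: leq_sum => i _; apply: ltnW.
suff -> : 'X_[m] = 'X_[m - U_(i) *+ N i] * 'X_i ^+ N i :> P by apply: hidealMl.
rewrite mpolyXn -mpolyXD submK //.
by apply/mnm_lepP => j; rewrite mulmnE mnm1E; case: eqP => [<-|_]; rewrite ?mul1n ?mul0n.
Qed.

Lemma hideal_addM (Q : P -> Prop) f k : homogeneous_ideal_axiom Q -> f \is k.-homog ->
  homogeneous_ideal_axiom (fun g => exists q a, Q q /\ g = q + a * f).
Proof.
move=> hQ fk; split; first split.
- by exists 0, 0; split; [exact: hideal0|rewrite mul0r addr0].
- move=> _ _ [q [a [Qq ->]]] [q' [a' [Qq' ->]]]; exists (q + q'), (a + a').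
  by split; [exact: hidealD|ring].
- move=> b _ [q [a [Qq ->]]]; exists (b * q), (b * a).
  by split; [exact: hidealMl|ring].
- move=> _ i [q [a [Qq ->]]]; rewrite linearD /= mulrC (pihomogM_homog i _ fk).
  have Qi := hidealH hQ i Qq.
  case: leqP => _; first by exists (pi i q), (pi (i - k) a); rewrite mulrC.
  by exists (pi i q), 0; rewrite mul0r.
Qed.

Lemma homog_prime (Q : P -> Prop) : homogeneous_ideal_axiom Q ->
  (forall f g k l, f \is k.-homog -> g \is l.-homog -> Q (f * g) -> Q f \/ Q g) ->
  forall f g, Q (f * g) -> Q f \/ Q g.
Proof.
move=> hQ prQ f g Qfg; apply: contrapT => /not_orP [nf ng].
have low h : ~ Q h -> exists a, ~ Q (pi a h) /\ forall b, (b < a)%N -> Q (pi b h).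
  move=> nh; have exN : exists a, `[< ~ Q (pi a h) >].
    apply: contrapT => H; apply: nh; apply: (hideal_components hQ) => d.
    by apply: contrapT => nd; apply: H; exists d; apply/asboolP.
  case: (ex_minnP exN) => a /asboolP na amin; exists a; split=> // b ba.
  apply: contrapT => nb; move: ba; rewrite ltnNge => /negP; apply.
  by apply: amin; apply/asboolP.
have [a [na la]] := low _ nf; have [b [nb lb]] := low _ ng.
have: Q (pi a f * pi b g).
  have := hidealH hQ (a + b) Qfg; rewrite pihomogM.
  have lt : (a < (a + b).+1)%N by rewrite ltnS leq_addr.
  rewrite (bigD1 (Ordinal lt)) //= addKn => Qs.
  rewrite -[X in Q X](addrK (\sum_(i < (a + b).+1 | i != Ordinal lt)
      pi i f * pi (a + b - i) g)).
  apply: hidealB => //; apply: hideal_sum => // i; rewrite -val_eqE /= neq_ltn.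
  case/orP => ia; first by apply: hidealMr => //; apply: la.
  by apply: hidealMl => //; apply: lb; have := ltn_ord i; lia.
by case/(prQ _ _ _ _ (pihomogP _ _ _) (pihomogP _ _ _)).
Qed.

Lemma exists_point (J : P -> Prop) : homogeneous_ideal_axiom J ->
  (forall k, exists2 m : 'X_{1..n.+1}, mdeg m = k & ~ J 'X_[m]) ->
  exists q : point K n, forall f, J f -> q f.
Proof.
move=> hJ nJ; have [i ni] := no_variable_nilpotent hJ nJ.
pose T (S : P -> Prop) f := J f \/ S f.
pose good (S : P -> Prop) :=
  homogeneous_ideal_axiom (T S) /\ forall N, ~ T S ('X_i ^+ N).
have [S [[hQ nQ] maxS]] : exists S, good S /\
    forall B, classical_sets.proper S B -> ~ good B.
  apply: classical_sets.Zorn_bigcup => F FP totF.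
  have TS (S : P -> Prop) : F S -> forall f, T S f ->
      T (classical_sets.bigcup F (fun S => S)) f.
    by move=> FS f [Jf|Sf]; [left|right; exists S].
  split; last first.
    move=> N [/ni //|[S FS SN]].
    by have [_ /(_ N)[]] := FP _ FS; right.
  split; first split.
  - by left; exact: hideal0.
  - move=> f g [Jf|[S FS Sf]] [Jg|[S' FS' Sg]].
    + by left; exact: hidealD.
    + by apply: (TS _ FS'); apply: (hidealD (FP _ FS').1); [left|right].
    + by apply: (TS _ FS); apply: (hidealD (FP _ FS).1); [right|left].
    + case: (totF S S') => // sub.
        by apply: (TS _ FS'); apply: (hidealD (FP _ FS').1); right=> //; apply: sub.
      by apply: (TS _ FS); apply: (hidealD (FP _ FS).1); right=> //; apply: sub.
  - move=> a f [Jf|[S FS Sf]]; first by left; exact: hidealMl.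
    by apply: (TS _ FS); apply: (hidealMl _ (FP _ FS).1); right.
  - move=> f d [Jf|[S FS Sf]]; first by left; exact: hidealH.
    by apply: (TS _ FS); apply: (hidealH (FP _ FS).1); right.
have grow f k : f \is k.-homog -> ~ T S f ->
    exists N q a, T S q /\ 'X_i ^+ N = q + a * f.
  move=> fk nf; pose B g := exists q a, T S q /\ g = q + a * f.
  have hB := hideal_addM hQ fk.
  have SB g : T S g -> B g by move=> Sg; exists g, 0; rewrite mul0r addr0.
  apply: contrapT => H; apply: (maxS B).
    split=> [g Sg|/(_ f) sub]; first by apply: SB; right.
    by apply/nf; right; apply: sub; exists 0, 1; split; [exact: hideal0|ring].
  have TB : T B = B by apply/funext => g; apply/propext; split=> [[Jg|//]|];
    [apply: SB; left|right].
  by split; rewrite TB // => N [q [a H']]; apply: H; exists N, q, a.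
have prQ : forall f g, T S (f * g) -> T S f \/ T S g.
  apply: homog_prime => // f g k l fk gl Qfg; apply: contrapT => /not_orP[nf ng].
  have [N [q [a [Qq e]]]] := grow _ _ fk nf.
  have [N' [q' [a' [Qq' e']]]] := grow _ _ gl ng.
  apply: (nQ (N + N')%N); rewrite exprD e e'.
  have -> : (q + a * f) * (q' + a' * g) =
    (q' + a' * g) * q + a * f * q' + a * a' * (f * g) by ring.
  by apply: hidealD => //; [apply: hidealD => //|]; apply: hidealMl.
have pr1 : ~ T S 1 by have := nQ 0%N; rewrite expr0.
have rel : exists i, ~ T S 'X_i by exists i; have := nQ 1%N; rewrite expr1.
by exists (Point hQ pr1 prQ rel) => f Jf; left.
Qed.

End HomogeneousIdeals.

(** * The coordinate ring, local rings and germs *)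

Section CoordinateRing.
Variables (K : fieldType) (n : nat) (X : subscheme K n).
Local Notation P := {mpoly K[n.+1]}.
Local Notation X0 := ('X_ord0 : P).
Local Notation pi := (@pihomog n.+1 K mdeg).
Local Notation hX := (vanishing_idealP X).

Lemma classK (z : coord_ring X) : z = class X (fnum z).
Proof.
have h : fden z = 1 := frac_adm z.
by rewrite -{1}(frac_ofK z) h.
Qed.

Lemma class_eq f g : class X f = class X g <-> X (f - g).
Proof.
split.
  case/(frac_ofP (F := coord_sys hX) (erefl 1 : fs_adm (coord_sys hX) f 1)
         (erefl 1 : fs_adm (coord_sys hX) g 1)) => h -> /=.
  by rewrite !mulr1 mul1r.
move=> Xfg; apply/frac_ofP => //; exists 1; first exact: adm01.
by rewrite !mulr1 mul1r.
Qed.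

Lemma class_eq0 f : class X f = 0 <-> X f.
Proof. by rewrite frac0E -[frac_of _ 0 1]/(class X 0) class_eq subr0. Qed.

Lemma classP (c : K) f g : class X (c *: f + g) = c *: class X f + class X g.
Proof. by rewrite /class frac_ofZ // frac_ofD // !mulr1. Qed.

Lemma classM f g : class X (f * g) = class X f * class X g.
Proof. by rewrite /class frac_ofM // !mulr1. Qed.

Lemma classX f k : class X (f ^+ k) = class X f ^+ k.
Proof. by elim: k => [//|k IH]; rewrite !exprS classM IH. Qed.

Definition graded_piece (i : nat) (z : coord_ring X) :=
  exists2 f, f \is i.-homog & z = class X f.

Lemma class_piece i f : f \is i.-homog -> graded_piece i (class X f).
Proof. by move=> fi; exists f. Qed.

Lemma hdeg_coord (i : nat) (z : coord_ring X) : hdeg i%:Z z <-> graded_piece i z.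
Proof.
split=> [[->|[k [l [f [g [fk gl /= a e ->]]]]]]|[f fi ->]].
- by exists 0; rewrite ?rpred0 //; apply/esym/class_eq0/(hideal0 hX).
- exists f; last by rewrite /class -a.
  have gN0 : g != 0 by rewrite a oner_eq0.
  have l0 : l = 0%N by apply: dhomog_uniq gN0 gl _; rewrite a; exact: dhomog1.
  by move: e; rewrite l0 subr0 => -[->].
- right; exists i, 0%N, f, 1; split=> //; first exact: dhomog1.
  by rewrite subr0.
Qed.

Lemma subspace_piece i : subspace (graded_piece i).
Proof.
split; first by exists 0; [exact: rpred0|apply/esym/class_eq0/(hideal0 hX)].
move=> c _ _ [f fi ->] [g gi ->]; exists (c *: f + g); last by rewrite classP.
by rewrite rpredD ?rpredZ.
Qed.

Lemma findim_piece i : findim (graded_piece i).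
Proof.
have [k [e eP]] := homog_spans K n i; exists k, (class X \o e) => _ [f fi ->].
have [c ->] := eP f fi; exists c.
have c0 : class X 0 = 0 by [].
by elim/big_rec2: _ => // j z g _ <-; rewrite classP.
Qed.

Lemma HF_piece i : HF_scheme X i = dim (graded_piece i).
Proof.
apply: eq_dim => z; rewrite /component -hdeg_coord.
by split=> [[]//|].
Qed.

End CoordinateRing.

Arguments graded_piece {K n} X i z.

Section LocalRing.
Variables (K : fieldType) (n : nat) (X : subscheme K n) (q : point K n).
Local Notation P := {mpoly K[n.+1]}.
Local Notation X0 := ('X_ord0 : P).
Local Notation pi := (@pihomog n.+1 K mdeg).
Local Notation hX := (vanishing_idealP X).
Local Notation O := (local_ring X q).
Local Notation hq := (point_idealP q).

Lemma local_eq0 f g : fs_adm (local_sys hX q) f g ->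
  (frac_of _ f g : O) = 0 <->
  exists h, [/\ exists k, h \is k.-homog, ~ q h & X (h * f)].
Proof.
move=> a; split=> [/(frac_of_eq0 a)[h [[k [_ hk]] nh] Xh]|[h [[k hk] nh Xh]]].
  by exists h; split=> //; exists k.
by apply/(frac_of_eq0 a); exists h => //; split=> //; exists k; rewrite rpred0.
Qed.

Lemma local_map_of (Y : subscheme K n) f g : is_subscheme Y X ->
  fs_adm (local_sys hX q) f g ->
  local_map (X := X) Y (frac_of _ f g : O) = frac_of _ f g.
Proof. by move=> YX a; apply: frac_map_of. Qed.

Lemma local_map_lin (Y : subscheme K n) (c : K) (x y : O) : is_subscheme Y X ->
  local_map Y (c *: x + y) = c *: local_map Y x + local_map Y y.
Proof. by move=> YX; apply: frac_mapP. Qed.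

Lemma local_mapM (Y : subscheme K n) (x y : O) : is_subscheme Y X ->
  local_map Y (x * y) = local_map Y x * local_map Y y.
Proof. by move=> YX; apply: frac_mapM. Qed.

Lemma local_map0 (Y : subscheme K n) : is_subscheme Y X ->
  local_map Y (0 : O) = 0.
Proof. by move=> YX; apply: frac_map0. Qed.

Lemma local_map_surj (Y : subscheme K n) : is_subscheme Y X ->
  forall y : local_ring Y q, exists x : O, local_map Y x = y.
Proof. by move=> YX; apply: frac_map_surj. Qed.

Section InScheme.
Hypothesis Xq : in_scheme X q.

Lemma residue_of f g : fs_adm (local_sys hX q) f g ->
  residue (frac_of _ f g : O) = frac_of _ f g.
Proof. exact: frac_map_of. Qed.

Lemma residue_lin (c : K) (x y : O) :
  residue (c *: x + y) = c *: residue x + residue y.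
Proof. exact: frac_mapP. Qed.

Lemma residueM (x y : O) : residue (x * y) = residue x * residue y.
Proof. exact: frac_mapM. Qed.

Lemma residue0 : residue (0 : O) = 0.
Proof. exact: frac_map0. Qed.

Lemma residue_surj (y : residue_field q) : exists x : O, residue x = y.
Proof. exact: frac_map_surj. Qed.

Lemma residue_of_eq0 f g : fs_adm (local_sys hX q) f g ->
  residue (frac_of _ f g : O) = 0 <-> q f.
Proof.
move=> a; rewrite (residue_of a); have a' : fs_adm (local_sys hq q) f g by [].
split=> [/(frac_of_eq0 a')[h [_ nh] /point_prime[//|//]]|qf].
apply/(frac_of_eq0 a'); exists 1; last by rewrite mul1r.
by split; [exists 0%N; rewrite rpred0 dhomog1|exact: point_proper].
Qed.

Lemma residue1_neq0 : residue (1 : O) <> 0.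
Proof.
move/(residue_of_eq0 (fs_adm1 (local_sys hX q))).
exact: point_proper.
Qed.

Lemma local_unit (x : O) : residue x <> 0 -> exists y, x * y = 1.
Proof.
elim/frac_elim: x => f g a nf; have [[i [fi gi]] ng] := a.
have nqf : ~ q f by move/(residue_of_eq0 a).
have a' : fs_adm (local_sys hX q) g f by split=> //; exists i.
exists (frac_of _ g f); rewrite frac_ofM //.
apply: frac_of_eq; [exact: fs_admM|exact: fs_adm1|ring].
Qed.

End InScheme.

Section Germs.
Hypothesis nqX0 : ~ q X0.

Lemma nqX0X i : ~ q (X0 ^+ i).
Proof.
elim: i => [|i IH]; first by rewrite expr0; exact: point_proper.
by rewrite exprS => /point_prime[].
Qed.

Definition hgerm i (f : P) : O := frac_of _ f (X0 ^+ i).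

Lemma hgerm_adm i f : f \is i.-homog -> fs_adm (local_sys hX q) f (X0 ^+ i).
Proof. by move=> fi; split; [exists i; split=> //; exact: dhomogX0|exact: nqX0X]. Qed.

Lemma hgerm_eq0 i f : f \is i.-homog -> (hgerm i f = 0 <->
  exists h, [/\ exists k, h \is k.-homog, ~ q h & X (h * f)]).
Proof. by move=> fi; apply: local_eq0; apply: hgerm_adm. Qed.

Lemma hgerm_lin i (c : K) f g : f \is i.-homog -> g \is i.-homog ->
  hgerm i (c *: f + g) = c *: hgerm i f + hgerm i g.
Proof.
move=> fi gi; have cfi : c *: f \is i.-homog by rewrite rpredZ.
rewrite /hgerm frac_ofZ ?frac_ofD //; try exact: hgerm_adm.
apply: frac_of_eq; first by apply: hgerm_adm; rewrite rpredD.
  by apply: fs_admD; apply: hgerm_adm.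
ring.
Qed.

Lemma hgermM i k f g : f \is i.-homog -> g \is k.-homog ->
  hgerm (i + k) (f * g) = hgerm i f * hgerm k g.
Proof.
by move=> fi gk; rewrite /hgerm frac_ofM ?exprD //; exact: hgerm_adm.
Qed.

Lemma hgerm0 i : hgerm i 0 = 0.
Proof. by apply: frac_of0; apply: hgerm_adm; exact: rpred0. Qed.

Lemma hgermX0 i : hgerm i (X0 ^+ i) = 1.
Proof.
apply: frac_of_eq; [|exact: fs_adm1|by rewrite mulr1 mul1r].
by apply: hgerm_adm; exact: dhomogX0.
Qed.

Lemma hgerm_X0M i k f : f \is k.-homog -> hgerm (i + k) (X0 ^+ i * f) = hgerm k f.
Proof. by move=> fk; rewrite hgermM ?hgermX0 ?mul1r //; exact: dhomogX0. Qed.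

Lemma hgerm_ideal i f : f \is i.-homog -> X f -> hgerm i f = 0.
Proof.
move=> fi Xf; apply/(hgerm_eq0 fi); exists 1; split; last by rewrite mul1r.
  by exists 0%N; exact: dhomog1.
exact: point_proper.
Qed.

Lemma hgerm_mod i f g : f \is i.-homog -> g \is i.-homog -> X (f - g) ->
  hgerm i f = hgerm i g.
Proof.
move=> fi gi Xfg; apply/eqP; rewrite -subr_eq0 addrC -scaleN1r -hgerm_lin //.
by apply/eqP/hgerm_ideal; rewrite scaleN1r addrC // rpredB.
Qed.

Lemma germ_class i f : germ q i (class X f) = hgerm i (pi i f).
Proof.
apply: hgerm_mod; try exact: pihomogP.
rewrite -linearB /=; apply: (hidealH hX).
by apply/class_eq; rewrite -classK.
Qed.

Lemma germ_class_homog i f : f \is i.-homog -> germ q i (class X f) = hgerm i f.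
Proof. by move=> fi; rewrite germ_class pihomog_dE. Qed.

Lemma germ_lin i (c : K) (x y : coord_ring X) :
  germ q i (c *: x + y) = c *: germ q i x + germ q i y.
Proof.
rewrite (classK x) (classK y) -classP !germ_class linearP /=.
by apply: hgerm_lin; apply: pihomogP.
Qed.

End Germs.
End LocalRing.

(* Conversion tests between distinct fractions otherwise unfold the quotient
   down to the choice of representatives and practically diverge. *)
Local Opaque frac_of fadd fmul fscale frac_map natmin.

(** * Socles and the surjection of R_r onto the product of the local rings *)

Lemma unit_mul_eq0 (A : comPzRingType) (u y t : A) : u * y = 1 -> u * t = 0 -> t = 0.
Proof. by move=> uy ut; rewrite -[t]mul1r -uy mulrAC ut mul0r. Qed.

Section Socle.
Variables (K : fieldType) (n : nat) (X : subscheme K n) (q : point K n).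
Local Notation O := (local_ring X q).
Hypothesis Xq : in_scheme X q.
Hypothesis fO : findim (fun _ : O => True).

Definition principal (a y : O) := exists b, y = b * a.

Lemma subspace_principal a : subspace (principal a).
Proof.
split; first by exists 0; rewrite mul0r.
by move=> c _ _ [b ->] [b' ->]; exists (c *: b + b'); rewrite frac_mulr_lin.
Qed.

Lemma findim_principal a : findim (principal a).
Proof. exact: findim_sub fO. Qed.

Lemma socle_nonzero (J : O -> Prop) (a : O) :
  (forall b x, J x -> J (b * x)) -> J a -> a <> 0 ->
  exists t, [/\ J t, t <> 0 & in_socle t].
Proof.
move=> JM Ja a0.
have exm : exists m, `[< exists a, [/\ J a, a <> 0 & dim (principal a) = m] >].
  by exists (dim (principal a)); apply/asboolP; exists a.
case: (ex_minnP exm) => m /asboolP[t [Jt t0 <-]] tmin {a Ja a0 exm m}.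
exists t; split; [exact: Jt|exact: t0|move=> b b0; apply: contrapT => bt0].
have [c tE] : principal (b * t) t.
  apply: (dim_leq_eq (subspace_principal (b * t)) (subspace_principal t)).
  - exact: findim_principal.
  - by move=> _ [c ->]; exists (c * b); rewrite mulrA.
  - apply: tmin; apply/asboolP; exists (b * t).
    by split; [exact: JM|exact: bt0|].
  - by exists 1; rewrite mul1r.
have [y y1] : exists y, (- 1 *: (c * b) + 1) * y = 1.
  apply: (local_unit Xq).
  by rewrite (residue_lin Xq) (residueM Xq) b0 mulr0 scaler0 add0r; exact: residue1_neq0.
apply: t0; apply: (unit_mul_eq0 y1).
rewrite frac_mulr_lin mul1r -mulrA -tE scaleN1r; exact: addNr.
Qed.

Lemma socle_annihilator (t b : O) : in_socle t -> t <> 0 -> (b * t = 0 <-> residue b = 0).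
Proof.
move=> st t0; split=> [bt0|]; last exact: st.
apply: contrapT => /(local_unit Xq)[y y1]; exact: t0 (unit_mul_eq0 y1 bt0).
Qed.

Lemma findim_residue : findim (fun _ : residue_field q => True).
Proof.
have [k [e se]] := findim_image (residue_lin Xq) fO.
exists k, e => y _; have [x xy] := residue_surj Xq y.
by apply: se; exists x.
Qed.

Lemma dim_principal_socle t : in_socle t -> t <> 0 ->
  dim (principal t) = dim (fun _ : residue_field q => True).
Proof.
move=> st t0.
rewrite -(dim_image_surj (residue_surj Xq)).
rewrite -(eq_kernel_dim_image (frac_mulr_lin t) (residue_lin Xq) (@subspaceT _ _) fO).
  by apply: eq_dim => y; split=> [[b ->]|[b _ <-]]; exists b.
by move=> b; apply: socle_annihilator.
Qed.

Lemma dim_residue_gt0 : (0 < dim (fun _ : residue_field q => True))%N.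
Proof.
apply: (@dim_gt0 _ _ _ (residue (1 : O))) => //; first exact: findim_residue.
exact: residue1_neq0.
Qed.

End Socle.

Section ZeroDimensional.
Variables (K : fieldType) (n : nat) (X : subscheme K n).
Local Notation P := {mpoly K[n.+1]}.
Local Notation X0 := ('X_ord0 : P).
Local Notation pi := (@pihomog n.+1 K mdeg).
Local Notation hX := (vanishing_idealP X).
Variables (s : nat) (p : 'I_s -> point K n).
Hypothesis dimX : zero_dimensional X.
Hypothesis suppX : is_support X p.
Hypothesis ncX0 : forall j, ~ p j X0.

Lemma support_in_scheme j : in_scheme X (p j).
Proof. by case: suppX => /(_ j)[]. Qed.

Lemma homog_locally_zero i f : f \is i.-homog ->
  (forall j, exists2 h, ~ p j h & X (h * f)) -> X f.
Proof.
move=> fi locf; apply: contrapT => nf.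
have hJ : homogeneous_ideal_axiom (fun h => X (h * f)).
  split; first split.
  - by rewrite mul0r; exact: (hideal0 hX).
  - by move=> g h Xg Xh; rewrite mulrDl; apply: (hidealD hX).
  - by move=> a h Xh; rewrite -mulrA; apply: (hidealMl _ hX).
  - move=> h d Xh; rewrite mulrC -(pihomogM_homogD _ _ fi) mulrC.
    exact: (hidealH hX).
have [|q Jq] := exists_point hJ.
  move=> k; apply: contrapT => H; apply: nf; apply: vanishing_ideal_saturated.
  by exists k => m mk; apply: contrapT => nm; apply: H; exists m.
have Xq : in_scheme X q by move=> g Xg; apply: Jq; apply: (hidealMr _ hX).
have [_ _ /(_ q) H] := suppX; have [|j jq] := H.
  split=> // q' qq'; apply: dimX.2 => //.
  by move=> g /Xq; exact: qq'.
by have [h + /Jq] := locf j; rewrite jq.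
Qed.

Lemma hgerms_zero i f : f \is i.-homog ->
  (forall j, hgerm X (p j) i f = 0) -> X f.
Proof.
move=> fi f0; apply: (homog_locally_zero fi) => j.
have [h [_ nh Xh]] := (hgerm_eq0 X (ncX0 (j:=j)) fi).1 (f0 j).
by exists h.
Qed.

Lemma X0_regular f : X (X0 * f) -> X f.
Proof.
move=> Xf; apply: (hideal_components hX) => d.
apply: (homog_locally_zero (pihomogP _ _ _)) => j; exists X0 => //.
rewrite -(pihomogM_homogD d f (dhomogX0 K n 1)); exact: (hidealH hX).
Qed.

Lemma X0X_regular k f : X (X0 ^+ k * f) -> X f.
Proof.
elim: k f => [|k IH] f; first by rewrite expr0 mul1r.
by rewrite exprS -mulrA => /X0_regular/IH.
Qed.

Variable r : nat.
Hypothesis regX : regularity_index p X r.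

Lemma dim_piece i : (r <= i)%N -> dim (graded_piece X i) = degree p X.
Proof. by move=> ri; rewrite -HF_piece; apply: regX.1. Qed.

Lemma regular_mul_surj l i v f : v \is l.-homog -> (forall h, X (v * h) -> X h) ->
  (r <= i)%N -> f \is (l + i).-homog ->
  exists2 w, w \is i.-homog & X (f - v * w).
Proof.
move=> vl regv ri fli.
have lin := frac_mull_lin (class X v).
have : lin_image (fun z => class X v * z) (graded_piece X i) (class X f).
  apply: (dim_leq_eq (subspace_image lin (subspace_piece X i))
    (subspace_piece X (l + i)) (findim_piece X (l + i))); last by exists f.
    move=> _ [_ [w wi ->] <-]; exists (v * w); last by rewrite classM.
    exact: dhomogM.
  rewrite (dim_image_inj lin) ?dim_piece //.
  - by apply: leq_trans ri _; apply: leq_addl.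
  - exact: subspace_piece.
  - exact: findim_piece.
  - by move=> _ [w wi ->]; rewrite -classM => /class_eq0/regv/class_eq0.
by case=> _ [w wi ->]; rewrite -classM => /esym/class_eq Xfw; exists w.
Qed.

Lemma X0_mul_surj k i f : (r <= i)%N -> f \is (k + i).-homog ->
  exists2 w, w \is i.-homog & X (f - X0 ^+ k * w).
Proof. by apply: regular_mul_surj; [exact: dhomogX0|exact: X0X_regular]. Qed.

Lemma hgerm_lift j k i f : (r <= i)%N -> f \is k.-homog ->
  exists2 w, w \is i.-homog & hgerm X (p j) i w = hgerm X (p j) k f.
Proof.
move=> ri fk.
have fk' : X0 ^+ i * f \is (k + i).-homog.
  by rewrite addnC; apply: dhomogM => //; exact: dhomogX0.
have [w wi Xw] := X0_mul_surj ri fk'; exists w => //.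
rewrite -(hgerm_X0M X (ncX0 (j:=j)) k wi) -(hgerm_X0M X (ncX0 (j:=j)) i fk) (addnC i).
symmetry; apply: hgerm_mod => //.
by apply: dhomogM => //; exact: dhomogX0.
Qed.

Lemma germ_piece_surj j (y : local_ring X (p j)) :
  exists2 w, w \is r.-homog & hgerm X (p j) r w = y.
Proof.
pose S := lin_image (germ (p j) r) (graded_piece X r).
have lin := germ_lin (X := X) (ncX0 (j:=j)) r.
have sS : subspace S := subspace_image lin (subspace_piece X r).
have fS : findim S := findim_image lin (findim_piece X r).
have Sgerm k f : f \is k.-homog -> S (hgerm X (p j) k f).
  move=> fk; have [w wr <-] := hgerm_lift j (leqnn r) fk.
  exists (class X w); first exact: class_piece.
  exact: (germ_class_homog X (ncX0 (j:=j)) wr).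
have SP x : S x -> exists2 w, w \is r.-homog & hgerm X (p j) r w = x.
  move=> [_ [w wr ->] <-]; exists w; first exact: wr.
  by symmetry; exact: (germ_class_homog X (ncX0 (j:=j)) wr).
have SM x x' : S x -> S x' -> S (x * x').
  move=> /SP[w wr <-] /SP[w' w'r <-]; rewrite -hgermM //.
  by apply: Sgerm; exact: dhomogM.
apply: SP; elim/frac_elim: y => f g [[i [fi gi]] ng].
pose c := hgerm X (p j) i g.
have [c' c'1] : exists c', c * c' = 1.
  apply: (local_unit (@support_in_scheme j)) => /residue_of_eq0.
  by move=> /(_ (@support_in_scheme j) (hgerm_adm X (ncX0 (j:=j)) gi)).
have linc := frac_mull_lin c.
have [x Sx cx] : lin_image (fun x => c * x) S 1.
  apply: (dim_leq_eq (subspace_image linc sS) sS fS).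
  - by move=> _ [x Sx <-]; apply: SM => //; exact: Sgerm.
  - apply: eq_leq; symmetry; apply: (dim_image_inj linc sS fS) => x _ cx0.
    exact: unit_mul_eq0 c'1 cx0.
  - by rewrite -(hgermX0 X (ncX0 (j:=j)) 0); apply: Sgerm; exact: dhomogX0.
suff -> : frac_of _ f g = hgerm X (p j) i f * x by apply: SM => //; exact: Sgerm.
have a : fs_adm (local_sys hX (p j)) f g by split=> //; exists i.
rewrite -[LHS]mulr1 -cx mulrA; congr (_ * x).
have aX h : h \is i.-homog -> fs_adm (local_sys hX (p j)) h (X0 ^+ i).
  exact: hgerm_adm.
rewrite frac_ofM //; last exact: aX.
apply: frac_of_eq; [apply: fs_admM => //; exact: aX|exact: aX|ring].
Qed.

Lemma findim_local j : findim (fun _ : local_ring X (p j) => True).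
Proof.
have lin := germ_lin (X := X) (ncX0 (j:=j)) r.
have [k [e se]] := findim_image lin (findim_piece X r).
exists k, e => y _; apply: se; have [w wr <-] := germ_piece_surj y.
exists (class X w); first exact: class_piece.
exact: (germ_class_homog X (ncX0 (j:=j)) wr).
Qed.

Lemma hgerms_surj j (a : local_ring X (p j)) : exists f, [/\ f \is r.-homog,
  hgerm X (p j) r f = a & forall k, k != j -> hgerm X (p k) r f = 0].
Proof.
have lin j := germ_lin (X := X) (ncX0 (j:=j)) r.
have inj z : graded_piece X r z -> (forall k, germ (p k) r z = 0) -> z = 0.
  move=> [f fr ->] f0; apply/class_eq0/(hgerms_zero fr) => k.
  by rewrite -(germ_class_homog X (ncX0 (j:=k)) fr); exact: f0.
have dimr := eq_leq (esym (dim_piece (leqnn r))).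
have [z [[f fr ->] fa f0]] := joint_surjective lin (subspace_piece X r)
  (findim_piece X r) findim_local inj dimr a.
exists f; split=> [||k /f0]; [exact: fr| |].
  by rewrite -(germ_class_homog X (ncX0 (j:=j)) fr); exact: fa.
by rewrite (germ_class_homog X (ncX0 (j:=k)) fr).
Qed.

End ZeroDimensional.

(** * Maximal subschemes *)

Section Subschemes.
Variables (K : fieldType) (n : nat) (X : subscheme K n).
Local Notation P := {mpoly K[n.+1]}.
Local Notation X0 := ('X_ord0 : P).
Local Notation pi := (@pihomog n.+1 K mdeg).
Local Notation hX := (vanishing_idealP X).
Variables (s : nat) (p : 'I_s -> point K n).
Hypothesis dimX : zero_dimensional X.
Hypothesis suppX : is_support X p.
Hypothesis ncX0 : forall j, ~ p j X0.
Variable r : nat.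
Hypothesis regX : regularity_index p X r.
Local Notation Xp := (fun j => @support_in_scheme K n X s p suppX j).
Local Notation fO := (findim_local dimX suppX ncX0 regX).
Local Notation O := (fun j => local_ring X (p j)).

Lemma degree_p_subscheme j Y : is_p_subscheme p X j Y ->
  (degree p Y + dim (lin_kernel (@local_map K n X Y (p j)) (fun _ => True)))%N
  = degree p X.
Proof.
move=> [YX bijY surjY]; rewrite /degree (bigD1 j) //= [RHS](bigD1 j) //=.
rewrite addnAC; congr (_ + _)%N.
  have lin (c : K) (x y : O j) := local_map_lin c x y YX.
  by rewrite (rank_nullity lin (@subspaceT _ _) (fO j)) addnC (dim_image_surj surjY).
apply: eq_bigr => k kj; have [g fK gK] := bijY k kj.
have lin (c : K) (x y : O k) := local_map_lin c x y YX.
transitivity (dim (lin_image (@local_map K n X Y (p k)) (fun _ => True))).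
  symmetry; apply: dim_image_surj => y; exists (g y); exact: gK.
apply: (dim_image_inj lin (@subspaceT _ _) (fO k)) => x _ x0.
apply: (can_inj fK); rewrite (local_map0 (p k) YX); exact: x0.
Qed.

Lemma maximal_kernel j Y : maximal_p_subscheme p X j Y ->
  exists t : O j, [/\ t <> 0, in_socle t &
    forall a, local_map Y a = 0 <-> exists b, a = b * t].
Proof.
move=> [pY maxY]; have [YX _ _] := pY.
have lin (c : K) (x y : O j) := local_map_lin c x y YX.
pose J := lin_kernel (@local_map K n X Y (p j)) (fun _ => True).
have dimJ : dim J = residue_degree p j.
  by apply/eqP; rewrite -(eqn_add2l (degree p Y)) maxY; apply/eqP/degree_p_subscheme.
have sJ : subspace J := subspace_kernel lin (@subspaceT _ _).
have fJ : findim J by apply: findim_sub (fO j).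
have [a Ja a0] : exists2 a, J a & a <> 0.
  apply: exists_nonzero sJ fJ _.
  rewrite dimJ; apply: dim_residue_gt0; [exact: Xp|exact: fO].
have JM (b x : O j) : J x -> J (b * x).
  by move=> [_ x0]; split; [exact: I|rewrite (local_mapM _ _ YX) x0; exact: mulr0].
have [t [Jt t0 st]] := socle_nonzero (Xp j) (fO j) JM Ja a0.
exists t; split; [exact: t0|exact: st|move=> x].
split=> [x0|[b ->]]; last exact: (JM b t Jt).2.
apply: (dim_leq_eq (subspace_principal t) sJ fJ).
- move=> _ [b ->]; exact: JM.
- by rewrite dimJ (dim_principal_socle (Xp j) (fO j) st t0).
- by split; [exact: I|exact: x0].
Qed.

Lemma is_mu_rel_exists j Y (t : O j) : t <> 0 -> in_socle t ->
  (forall a, local_map Y a = 0 <-> exists b, a = b * t) ->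
  exists m, is_mu_rel p X j Y m.
Proof.
move=> t0 st kY.
have [b bb] := dim_basis (@subspaceT _ _) (findim_residue (Xp j) (fO j)).
have /choice [e eb] : forall i, exists x : O j, residue x = b i.
  by move=> i; apply: residue_surj; exact: Xp.
eexists; exists t, e.
have eb' : (fun k => residue (e k)) = b by apply/funext.
split; [exact: t0|exact: st|exact: kY|rewrite eb'; exact: bb|reflexivity].
Qed.

Definition lifts_in_degree (d : nat) j (a : O j) := exists f, [/\ f \is d.-homog,
  hgerm X (p j) d f = a & forall k, k != j -> hgerm X (p k) d f = 0].

Lemma subspace_lifts d j : subspace (@lifts_in_degree d j).
Proof.
split.
  by exists 0; split=> [||k _]; rewrite ?rpred0 ?(hgerm0 X (ncX0 (j:=_))).
move=> c _ _ [f [fd <- f0]] [g [gd <- g0]]; exists (c *: f + g).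
split; first by rewrite rpredD ?rpredZ.
  by rewrite hgerm_lin.
by move=> k kj; rewrite hgerm_lin // f0 // g0 // scaler0 addr0.
Qed.

Lemma mu_lifts d j (a : O j) : (mu a <= d)%N -> lifts_in_degree d a.
Proof.
rewrite /mu; set A := fun i => _.
apply: (natmin_ind (Q := fun m => (m <= d)%N -> lifts_in_degree d a)).
  have [f [fr fa f0]] := hgerms_surj dimX suppX ncX0 regX a.
  exists r, (class X f); split; first by rewrite germ_class_homog.
  move=> k l nkl; rewrite germ_class //; have [lr|lr] := eqVneq r l.
    rewrite -lr pihomog_dE //; apply: f0; apply/eqP => kj.
    by apply: nkl.
  by rewrite (pihomog_ne0 lr fr); apply: hgerm0.
move=> i [rho [ga g0]] id.
exists (X0 ^+ (d - i) * pi i (fnum rho)); have hi := pihomogP mdeg i (fnum rho).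
have e : d = (d - i + i)%N by rewrite subnK.
rewrite [X in X.-homog]e [X in hgerm _ _ X]e; split.
- by apply: dhomogM => //; exact: dhomogX0.
- by rewrite hgerm_X0M.
- move=> k kj; rewrite [X in hgerm _ _ X]e hgerm_X0M //; apply: (g0 k i).
  by case=> kj' _; rewrite kj' eqxx in kj.
Qed.

Lemma is_mu_rel_lifts j Y m d : is_mu_rel p X j Y m -> (m <= d)%N ->
  exists t : O j, [/\ t <> 0, in_socle t &
    forall a, principal t a -> lifts_in_degree d a].
Proof.
move=> [t [e [t0 st _ bas ->]]] md; exists t; split=> // _ [b ->].
have [_ _ /(_ (residue b) I) [c cE]] := (is_basisP _ (@subspaceT _ _)).1 bas.
have b0 : residue (-1 *: (\sum_i c 0 i *: e i) + b) = 0.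
  rewrite (residue_lin (Xp j)) (lin_map_sum (residue_lin (Xp j))) -cE scaleN1r.
  exact: addNr.
have := st _ b0; rewrite frac_mulr_lin scaleN1r addrC => /subr0_eq ->.
rewrite mulr_suml.
rewrite (eq_bigr (fun i => c 0 i *: (e i * t))); last first.
  by move=> i _; symmetry; exact: frac_scaleAl.
apply: subspace_sum; first exact: subspace_lifts.
move=> i; apply: mu_lifts; apply: (leq_trans _ md).
exact: (leq_bigmax i).
Qed.

Section Hypersurface.
Variable f : P.
Local Notation A k := (principal (hgerm X (p k) r f)).

Let A0 k : A k 0. Proof. by exists 0; rewrite mul0r. Qed.
Let AD k x y : A k x -> A k y -> A k (x + y).
Proof. by move=> [a ->] [b ->]; exists (a + b); rewrite mulrDl. Qed.
Let AM k a x : A k x -> A k (a * x).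
Proof. by move=> [b ->]; exists (a * b); rewrite mulrA. Qed.

(* X cut by f, as a scheme: unlike I_X + (f), this ideal is saturated. *)
Definition hypersurface_ideal (g : P) : Prop :=
  forall i k, A k (hgerm X (p k) i (pi i g)).

Let hgermD k i g h : g \is i.-homog -> h \is i.-homog ->
  hgerm X (p k) i (g + h) = hgerm X (p k) i g + hgerm X (p k) i h.
Proof. by move=> gi hi; rewrite -[g]scale1r hgerm_lin ?scale1r. Qed.

Lemma hypersurface_homog i g : g \is i.-homog ->
  (hypersurface_ideal g <-> forall k, A k (hgerm X (p k) i g)).
Proof.
move=> gi; split=> [H k|H l k]; first by have := H i k; rewrite pihomog_dE.
have [<-|il] := eqVneq i l; first by rewrite pihomog_dE.
by rewrite (pihomog_ne0 il gi) hgerm0.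
Qed.

Lemma hypersurface_idealP : homogeneous_ideal_axiom hypersurface_ideal.
Proof.
split; first split.
- by move=> i k; rewrite linear0 hgerm0.
- move=> g h Ig Ih i k; rewrite linearD /= hgermD; try exact: pihomogP.
  by apply: AD.
- move=> a g Ig d k; rewrite pihomogM.
  suff [] : (\sum_(i < d.+1) pi i a * pi (d - i) g) \is d.-homog /\
    A k (hgerm X (p k) d (\sum_(i < d.+1) pi i a * pi (d - i) g)) by [].
  apply: (big_ind (fun h => h \is d.-homog /\ A k (hgerm X (p k) d h))).
  + by split; [exact: rpred0|rewrite hgerm0].
  + by move=> x y [xd Ax] [yd Ay]; split; [exact: rpredD|rewrite hgermD //; exact: AD].
  + move=> i _; have e : d = (i + (d - i))%N by rewrite subnKC // -ltnS.
    have hh : pi i a * pi (d - i) g \is d.-homog.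
      have := dhomogM (pihomogP mdeg i a) (pihomogP mdeg (d - i) g).
      by rewrite -e.
    split; first exact: hh.
    suff -> : hgerm X (p k) d (pi i a * pi (d - i) g) =
        hgerm X (p k) i (pi i a) * hgerm X (p k) (d - i) (pi (d - i) g).
      by apply: AM; apply: Ig.
    rewrite -(hgermM X (ncX0 (j:=k)) (pihomogP _ _ _) (pihomogP _ _ _)).
    by rewrite -e.
- move=> g i Ig; apply/(hypersurface_homog (pihomogP _ _ _)) => k; exact: Ig.
Qed.

Lemma hypersurface_saturated g : (exists k, forall m : 'X_{1..n.+1},
    mdeg m = k -> hypersurface_ideal ('X_[m] * g)) -> hypersurface_ideal g.
Proof.
move=> [k H] i l; have := H (U_(ord0) *+ k)%MM _ (k + i)%N l.
rewrite -mpolyXn (pihomogM_homogD _ _ (dhomogX0 K n k)).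
rewrite hgerm_X0M //; last exact: pihomogP.
by apply; rewrite mdegMn mdeg1 mul1n.
Qed.

Definition hypersurface := Subscheme hypersurface_idealP hypersurface_saturated.

Lemma hypersurface_sub : is_subscheme hypersurface X.
Proof.
move=> g Xg i k.
rewrite (hgerm_ideal (ncX0 (j:=k)) (pihomogP _ _ _) (hidealH hX i Xg)).
exact: A0.
Qed.

Lemma hypersurface_kernel k (x : O k) : local_map hypersurface x = 0 <-> A k x.
Proof.
elim/frac_elim: x => g h a; rewrite (local_map_of hypersurface_sub a).
have [[i [gi hi]] nh] := a.
have a' : fs_adm (local_sys (vanishing_idealP hypersurface) (p k)) g h by [].
have aX u : u \is i.-homog -> fs_adm (local_sys hX (p k)) u (X0 ^+ i).
  exact: hgerm_adm.
have gE : hgerm X (p k) i g = hgerm X (p k) i h * frac_of _ g h.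
  rewrite frac_ofM //; last exact: aX.
  by apply: frac_of_eq; [exact: aX|apply: fs_admM => //; exact: aX|ring].
have [y hy] : exists y, hgerm X (p k) i h * y = 1.
  apply: (local_unit (Xp k)) => /residue_of_eq0.
  by move=> /(_ (Xp k) (hgerm_adm X (ncX0 (j:=k)) hi)).
apply: iff_trans (local_eq0 a') _; split.
  move=> [u [[l ul] nu]] /(hypersurface_homog (dhomogM ul gi)) /(_ k).
  rewrite (hgermM X (ncX0 (j:=k)) ul gi) gE.
  have [z uz] : exists z, hgerm X (p k) l u * z = 1.
    apply: (local_unit (Xp k)) => /residue_of_eq0.
    by move=> /(_ (Xp k) (hgerm_adm X (ncX0 (j:=k)) ul)).
  move/(AM (z * y)); rewrite mulrACA [z * _]mulrC uz mul1r mulrA [y * _]mulrC hy.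
  by rewrite mul1r.
move=> Ax; have [u [ur u1 u0]] := hgerms_surj dimX suppX ncX0 regX (1 : O k).
exists u; split; first by exists r.
  move/(residue_of_eq0 (Xp k) (hgerm_adm X (ncX0 (j:=k)) ur)).
  by rewrite -[frac_of _ _ _]/(hgerm X (p k) r u) u1; exact: (residue1_neq0 (Xp k)).
apply/(hypersurface_homog (dhomogM ur gi)) => l.
rewrite (hgermM X (ncX0 (j:=l)) ur gi).
have [->|lk] := eqVneq l k; last by rewrite (u0 l lk) mul0r; exact: A0.
rewrite u1 gE; apply: (AM (k := k)); apply: (AM (k := k)); exact: Ax.
Qed.

End Hypersurface.

Lemma maximal_p_subscheme_exists j : exists (Y : subscheme K n) (m : nat),
  maximal_p_subscheme p X j Y /\ is_mu_rel p X j Y m.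
Proof.
have one0 : (1 : O j) <> 0.
  by move=> e; apply: (residue1_neq0 (Xp j)); rewrite e; exact: (residue0 (Xp j)).
have [t [_ t0 st]] := socle_nonzero (Xp j) (fO j) (J := fun _ => True)
  (fun _ _ _ => I) I one0.
have [f [fr ft f0]] := hgerms_surj dimX suppX ncX0 regX t.
pose Y := hypersurface f.
have YX := hypersurface_sub f : is_subscheme Y X.
have kY a : local_map Y a = 0 <-> exists b, a = b * t.
  by have := hypersurface_kernel f a; rewrite ft.
have [m Ym] := is_mu_rel_exists t0 st kY.
have pY : is_p_subscheme p X j Y.
  split=> [|k kj|]; [exact: YX| |exact: local_map_surj].
  have /choice [g gP] := local_map_surj (q := p k) YX.
  exists g => [x|]; last exact: gP.
  have : local_map Y (-1 *: x + g (local_map Y x)) = 0.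
    by rewrite (local_map_lin _ _ _ YX) gP scaleN1r; exact: addNr.
  move/(hypersurface_kernel f); rewrite (f0 k kj) => -[b].
  by rewrite mulr0 scaleN1r addrC => /subr0_eq.
exists Y, m; split; [split; [exact: pY|]|exact: Ym].
rewrite -(degree_p_subscheme pY); congr (_ + _)%N.
rewrite /residue_degree -(dim_principal_socle (Xp j) (fO j) st t0).
apply: eq_dim => a; split=> [/kY a0|[_ a0]]; last exact/kY.
by split; [exact: I|exact: a0].
Qed.

End Subschemes.

(** * The different *)

Section Different.
Variables (K : fieldType) (n : nat) (X : subscheme K n).
Local Notation P := {mpoly K[n.+1]}.
Local Notation X0 := ('X_ord0 : P).
Local Notation pi := (@pihomog n.+1 K mdeg).
Local Notation hX := (vanishing_idealP X).
Variables (s : nat) (p : 'I_s -> point K n).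
Hypothesis dimX : zero_dimensional X.
Hypothesis suppX : is_support X p.
Hypothesis ncX0 : forall j, ~ p j X0.
Variable r : nat.
Hypothesis regX : regularity_index p X r.
Local Notation Xp := (fun j => @support_in_scheme K n X s p suppX j).
Local Notation O := (fun j => local_ring X (p j)).
Local Notation Q := (hquot X).

Definition hq (N : nat) (f : P) : Q := frac_of _ f (X0 ^+ N).

Lemma hq_adm N f : fs_adm (quot_sys hX) f (X0 ^+ N).
Proof.
split; first by exists N; exact: dhomogX0.
by move=> h; exact: (X0X_regular dimX suppX ncX0).
Qed.

Lemma hq_eq N f g : hq N f = hq N g <-> X (f - g).
Proof.
split=> [/(frac_ofP (hq_adm N f) (hq_adm N g))[h [_ regh]] /regh|Xfg].
  by rewrite -mulrBl mulrC; exact: (X0X_regular dimX suppX ncX0).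
apply/(frac_ofP (hq_adm N f) (hq_adm N g)); exists 1; first exact: adm01.
rewrite mul1r -mulrBl; exact: (hidealMr _ hX).
Qed.

Lemma hqM M N f g : hq M f * hq N g = hq (M + N) (f * g).
Proof. by rewrite /hq (frac_ofM (hq_adm M f) (hq_adm N g)) -exprD. Qed.

Lemma hq_X0M M N f : hq (M + N) (X0 ^+ M * f) = hq N f.
Proof.
apply: (frac_of_eq (hq_adm _ _) (hq_adm _ _)).
by rewrite exprD; ring.
Qed.

Lemma hqP N (c : K) f g : hq N (c *: f + g) = c *: hq N f + hq N g.
Proof.
rewrite /hq (frac_ofZ c (hq_adm N f)) (frac_ofD (hq_adm N _) (hq_adm N g)).
apply: (frac_of_eq (hq_adm _ _)); first by rewrite -exprD; exact: hq_adm.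
by ring.
Qed.

Lemma hq0 N : hq N 0 = 0.
Proof. exact: frac_of0 (hq_adm N 0). Qed.

Lemma hq_eq0 N f : hq N f = 0 <-> X f.
Proof. by rewrite -(hq0 N) hq_eq subr0. Qed.

Lemma hqD N f g : hq N (f + g) = hq N f + hq N g.
Proof. by have := hqP N 1 f g; rewrite !scale1r; exact. Qed.

Lemma hq_sum N (I : finType) (f : I -> P) : hq N (\sum_i f i) = \sum_i hq N (f i).
Proof. exact: (big_morph (hq N) (hqD N) (hq0 N)). Qed.

Lemma coord_to_hquot_class f : coord_to_hquot (class X f) = hq 0 f.
Proof.
apply: frac_map_of; [by move=> g h ->; exact: quot_adm1|by []|reflexivity].
Qed.

Lemma coord_to_hquotP (c : K) (y z : coord_ring X) :
  coord_to_hquot (c *: y + z) = c *: coord_to_hquot y + coord_to_hquot z.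
Proof. by apply: frac_mapP => // g h ->; exact: quot_adm1. Qed.

Lemma over_x0_class f N : over_x0 (class X f) N = hq N f.
Proof. by rewrite /over_x0 coord_to_hquot_class hqM mulr1; reflexivity. Qed.

(* Denominators become powers of X0: multiplication by a homogeneous
   non-zerodivisor of degree l is onto from degree r to degree l + r, so it
   divides X0 ^+ (l + r) modulo X. *)
Lemma hquot_denominator f g l : fs_adm (quot_sys hX) f g -> g \is l.-homog ->
  exists2 w, w \is r.-homog & frac_of _ f g = hq (l + r) (f * w).
Proof.
move=> a gl; have [_ regg] := a.
have [w wr Xw] := regular_mul_surj regX gl regg (leqnn r)
  (dhomogX0 K n (l + r)).
exists w => //; apply/(frac_ofP a (hq_adm _ _)); exists 1; first exact: adm01.
have -> : 1 * (f * X0 ^+ (l + r) - f * w * g) = f * (X0 ^+ (l + r) - g * w) by ring.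
exact: (hidealMl _ hX).
Qed.

Lemma hquot_hq (z : Q) : exists N f, z = hq N f.
Proof.
elim/frac_elim: z => f g a; have [[l gl] _] := a.
by have [w _ e] := hquot_denominator a gl; exists (l + r)%N, (f * w).
Qed.

Lemma hdeg_hq (e : int) (z : Q) : hdeg e z <->
  exists N k f, [/\ f \is k.-homog, k%:Z = e + N%:Z & z = hq N f].
Proof.
split=> [[->|[k [l [f [g [fk gl a eE ->]]]]]]|[N [k [f [fk kE ->]]]]].
- exists (absz e), (absz (e + (absz e)%:Z)), 0; split; first exact: rpred0.
    by lia.
  by symmetry; exact: hq0.
- have [w wr ->] := hquot_denominator a gl.
  exists (l + r)%N, (k + r)%N, (f * w); split; [exact: dhomogM| |reflexivity].
  by rewrite eE; lia.
- right; exists k, N, f, (X0 ^+ N).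
  split; [exact: fk|exact: dhomogX0|exact: hq_adm| |reflexivity].
  by lia.
Qed.

Lemma sum_hq0_neg (M : nat) (z : 'I_M -> Q) (e : 'I_M -> int) (v : P) :
  injective e -> (forall i, hdeg (e i) (z i)) -> \sum_i z i = hq 0 v ->
  forall i, e i < 0 -> z i = 0.
Proof.
move=> inje hz sumz i0 e0.
have /choice [N /choice [k /choice [f fP]]] :
    forall i, exists N k f, [/\ f \is k.-homog, k%:Z = e i + N%:Z & z i = hq N f].
  by move=> i; apply/hdeg_hq.
pose L := (\sum_i N i)%N.
have NL i : (N i <= L)%N by rewrite /L (bigD1 i) //= leq_addr.
pose g i := X0 ^+ (L - N i) * f i.
have zE i : z i = hq L (g i).
  by have [_ _ ->] := fP i; rewrite -(hq_X0M (L - N i) (N i)) (subnK (NL i)); reflexivity.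
have gh i : g i \is (L - N i + k i).-homog.
  by have [fk _ _] := fP i; apply: dhomogM => //; exact: dhomogX0.
have kE i : (L - N i + k i)%N%:Z = e i + L%:Z.
  by have [_ H _] := fP i; have := NL i; lia.
have Xs : X (\sum_i g i - X0 ^+ L * v).
  apply/(hq_eq L); rewrite hq_sum -{2}(addn0 L) hq_X0M -sumz.
  by apply: eq_bigr => i _; symmetry; exact: zE.
rewrite zE; apply/hq_eq0.
have := hidealH hX (L - N i0 + k i0) Xs.
rewrite linearB linear_sum /= (pihomogM_homog _ _ (dhomogX0 K n L)).
rewrite ifF; last by apply/negbTE; have := kE i0; lia.
rewrite subr0 (bigD1 i0) //= big1 ?addr0 ?pihomog_dE // => i ii0.
apply: pihomog_ne0 (gh i); apply: contra ii0 => /eqP ee; apply/eqP/inje.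
by have := kE i; have := kE i0; rewrite ee; lia.
Qed.

Variable sigma : Q -> Q.
Hypothesis hsigma : homogeneous_trace_map0 sigma.

Lemma trace_add y z : sigma (y + z) = sigma y + sigma z.
Proof.
have [[m [e [psi [H sE]]]] _ _] := hsigma; rewrite !sE -big_split /=.
by apply: eq_bigr => t _; have [[_ Ht _] _] := H t; exact: Ht.
Qed.

Lemma trace_L0 l z : L0 l -> sigma (l * z) = l * sigma z.
Proof.
have [[m [e [psi [H sE]]]] _ _] := hsigma => Ll; rewrite !sE mulr_sumr.
by apply: eq_bigr => t _; have [[_ _ Ht] _] := H t; exact: Ht.
Qed.

Lemma trace0 : sigma 0 = 0.
Proof. by apply: (addIr (sigma 0)); rewrite -trace_add !add0r. Qed.

Lemma trace_sum (I : finType) (z : I -> Q) : sigma (\sum_i z i) = \sum_i sigma (z i).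
Proof.
exact: (big_morph sigma trace_add trace0).
Qed.

Lemma trace_nondegenerate y : (forall z, sigma (y * z) = 0) -> y = 0.
Proof.
move=> y0; have [_ _ H] := hsigma.
have [|g [_ uniq]] := H (fun _ => 0).
  exists 0%N, (fun _ => 0), (fun _ _ => 0); split=> [[]//|z].
  by rewrite big_ord0.
rewrite -(uniq y) => [|z]; last by rewrite y0.
by apply: uniq => z; rewrite mul0r trace0.
Qed.

Lemma L0_X0X k N : L0 (hq N (X0 ^+ k)).
Proof.
exists 'X^k, N; congr hq; rewrite /polyX0 size_polyXn big_ord_recr /= big1.
  by rewrite coefXn eqxx scale1r add0r.
by move=> i _; rewrite coefXn ltn_eqF ?scale0r.
Qed.

Lemma dedekind_compl_R g f : dedekind_compl sigma g ->
  exists v, sigma (g * hq 0 f) = hq 0 v.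
Proof.
move=> [phi [_ H]]; have := H (class X f) 0%N.
rewrite over_x0_class => ->; rewrite (classK (phi _)) over_x0_class.
by eexists.
Qed.

Section Vanishing.
Variables (d : nat) (j : 'I_s) (t : O j).
Hypothesis t0 : t <> 0.
Hypothesis lift_t : forall a, principal t a -> lifts_in_degree d a.

(* Modulo X, the product of such an f with a homogeneous h of degree b is
   X0 ^+ b times another such f; so the trace of u f vanishes against all of
   Q^h(R), and u f = 0 by nondegeneracy. *)
Lemma trace_zero_annihilates N i u : u \is i.-homog ->
  (forall f, f \is d.-homog -> principal t (hgerm X (p j) d f) ->
     (forall k, k != j -> hgerm X (p k) d f = 0) ->
     sigma (hq N u * hq 0 f) = 0) ->
  hgerm X (p j) i u * t = 0.
Proof.
move=> ui su.
have pt : principal t t by exists 1; rewrite mul1r.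
have [f [fd ft f0]] := lift_t pt.
suff uf0 : hq N u * hq 0 f = 0.
  move: uf0; rewrite hqM => /hq_eq0 Xuf.
  rewrite -ft -(hgermM X (ncX0 (j:=j)) ui fd).
  by apply: (hgerm_ideal (ncX0 (j:=j))) => //; exact: dhomogM.
apply: trace_nondegenerate => z; have [A [h ->]] := hquot_hq z.
have [M ->] := mpoly_sum_homog h; rewrite hq_sum mulr_sumr trace_sum.
apply: big1 => b _; pose hb := pi b h.
have hbb : hb \is b.-homog := pihomogP _ _ _.
have [f' [f'd f't f'0]] : lifts_in_degree d (hgerm X (p j) b hb * t).
  by apply: lift_t; exists (hgerm X (p j) b hb).
have Xf : X (X0 ^+ b * f' - hb * f).
  have h1 : X0 ^+ b * f' \is (b + d).-homog by apply: dhomogM => //; exact: dhomogX0.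
  have h2 : hb * f \is (b + d).-homog by apply: dhomogM.
  apply: (hgerms_zero dimX suppX ncX0 (rpredB h1 h2)) => k.
  rewrite addrC -scaleN1r (hgerm_lin X (ncX0 (j:=k)) _ h2 h1).
  rewrite (hgerm_X0M X (ncX0 (j:=k)) b f'd) (hgermM X (ncX0 (j:=k)) hbb fd).
  have [->|kj] := eqVneq k j; first by rewrite f't ft scaleN1r; exact: addNr.
  by rewrite (f'0 k kj) (f0 k kj) mulr0 scaler0; exact: addr0.
have -> : hq N u * hq 0 f * hq A hb = hq A (X0 ^+ b) * (hq N u * hq 0 f').
  rewrite !hqM addn0 addnC; apply/hq_eq.
  have -> : u * f * hb - X0 ^+ b * (u * f') = - u * (X0 ^+ b * f' - hb * f) by ring.
  exact: (hidealMl _ hX).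
rewrite (trace_L0 _ (L0_X0X b A)) su ?mulr0 //.
by rewrite f't; exists (hgerm X (p j) b hb).
Qed.

Lemma different_of_lift f0 : f0 \is r.-homog ->
  (forall b : O j, residue b = 0 -> b * hgerm X (p j) r f0 = 0) ->
  (forall k, k != j -> hgerm X (p k) r f0 = 0) ->
  dedekind_different sigma (hq 0 (X0 ^+ d * f0)).
Proof.
move=> f0r mf0 f00 g Cg; have [N [u gE]] := hquot_hq g.
have [M uE] := mpoly_sum_homog u.
have gsum : g = \sum_(i < M) hq N (pi i u) by rewrite gE {1}uE hq_sum.
have low (i : 'I_M) : (i + d < N)%N -> X (pi i u * f0).
  move=> idN; have ui := pihomogP mdeg i u.
  have ut : hgerm X (p j) i (pi i u) * t = 0.
    apply: (trace_zero_annihilates ui (N := N)) => f fd _ _.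
    have [v vE] := dedekind_compl_R f Cg.
    apply: (@sum_hq0_neg M (fun i => sigma (hq N (pi i u) * hq 0 f))
      (fun i => (i + d)%N%:Z - N%:Z) v).
    - by move=> i1 i2 e; apply: val_inj; move: e => /=; lia.
    - move=> k; have [_ sdeg _] := hsigma.
      rewrite -[X in hdeg X]addr0; apply: sdeg; apply/hdeg_hq.
      exists N, (k + d)%N, (pi k u * f); split; last by rewrite hqM addn0.
        by apply: dhomogM => //; exact: pihomogP.
      by lia.
    - by rewrite -trace_sum -mulr_suml -gsum.
    - by lia.
  have res0 : residue (hgerm X (p j) i (pi i u)) = 0.
    apply: contrapT => /(local_unit (Xp j))[y y1].
    exact: t0 (unit_mul_eq0 y1 ut).
  apply: (hgerms_zero dimX suppX ncX0 (dhomogM ui f0r)) => k.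
  rewrite (hgermM X (ncX0 (j:=k)) ui f0r).
  have [->|kj] := eqVneq k j; first exact: mf0.
  by rewrite (f00 k kj); exact: mulr0.
have /choice [w wE] : forall i : 'I_M, exists w,
    hq 0 (X0 ^+ d * f0) * hq N (pi i u) = hq 0 w.
  move=> i; rewrite hqM add0n; have ui := pihomogP mdeg i u.
  have [idN|Nid] := ltnP (i + d) N.
    exists 0; rewrite hq0; apply/hq_eq0.
    rewrite -mulrA [f0 * _]mulrC; apply: (hidealMl _ hX); exact: low.
  have hd : X0 ^+ d * f0 * pi i u \is (N + (i + d - N + r)).-homog.
    have -> : (N + (i + d - N + r) = d + r + i)%N by lia.
    by apply: dhomogM => //; apply: dhomogM => //; exact: dhomogX0.
  have [w _ Xw] := X0_mul_surj dimX suppX ncX0 regX (leq_addl (i + d - N) r) hd.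
  exists w; rewrite -(hq_X0M N 0 w) addn0; exact/hq_eq.
exists (class X (\sum_i w i)); rewrite coord_to_hquot_class hq_sum gsum mulr_sumr.
by apply: eq_bigr => i _; exact: wE.
Qed.

End Vanishing.

Lemma hdeg_nonneg_hq (e : nat) (z : Q) : (r <= e)%N ->
  (hdeg e%:Z z <-> exists2 f, f \is e.-homog & z = hq 0 f).
Proof.
move=> re; split=> [/hdeg_hq[N [k [f [fk kE ->]]]]|[f fe ->]].
  have ke : k = (N + e)%N by lia.
  rewrite ke in fk; have [w we Xw] := X0_mul_surj dimX suppX ncX0 regX re fk.
  exists w; first exact: we.
  by rewrite -(hq_X0M N 0 w) addn0; exact/hq_eq.
by apply/hdeg_hq; exists 0%N, e, f; split; [exact: fe|rewrite addr0|reflexivity].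
Qed.

Lemma different_component_subspace e : (r <= e)%N ->
  subspace (component (dedekind_different sigma) e%:Z).
Proof.
move=> re; split.
  split; last by left.
  by move=> g _; exists (class X 0); rewrite mul0r coord_to_hquot_class hq0.
move=> c y z [Dy /(hdeg_nonneg_hq _ re) [f fe yE]] [Dz /(hdeg_nonneg_hq _ re) [h he zE]].
split; last first.
  apply/(hdeg_nonneg_hq _ re); exists (c *: f + h); first by rewrite rpredD ?rpredZ.
  by rewrite hqP -yE -zE.
move=> g Cg; have [a aE] := Dy g Cg; have [b bE] := Dz g Cg.
exists (c *: a + b); rewrite frac_mulr_lin aE bE; symmetry.
exact: coord_to_hquotP.
Qed.

Lemma different_component_findim e : (r <= e)%N ->
  findim (component (dedekind_different sigma) e%:Z).
Proof.
move=> re; have [k [b bP]] := homog_spans K n e.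
exists k, (fun i => hq 0 (b i)) => _ [_ /(hdeg_nonneg_hq _ re) [f fe ->]].
have [c ->] := bP f fe; exists c.
exact: (lin_map_sum (phi := hq 0) (fun c f g => hqP 0 c f g)).
Qed.

End Different.

(** * Cayley-Bacharach property *)

Lemma maximal_p_subscheme_hgerm (K : fieldType) (n : nat) (X : subscheme K n)
    (s : nat) (p : 'I_s -> point K n) (dimX : zero_dimensional X)
    (suppX : is_support X p)
    (ncX0 : forall j, ~ p j ('X_ord0 : {mpoly K[n.+1]}))
    (r : nat) (regX : regularity_index p X r) (j : 'I_s) (Y : subscheme K n) :
  maximal_p_subscheme p X j Y ->
  forall i f, f \is i.-homog -> Y f ->
  (forall b : local_ring X (p j), residue b = 0 -> b * hgerm X (p j) i f = 0) /\
  (forall k, k != j -> hgerm X (p k) i f = 0).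
Proof.
move=> maxY i f fi Yf; have [[YX bijY _] _] := maxY.
have Y0 k : local_map Y (hgerm X (p k) i f) = 0.
  rewrite /hgerm (local_map_of YX (hgerm_adm X (ncX0 k) fi)).
  exact: (hgerm_ideal (X := Y) (ncX0 k) fi Yf).
split=> [b b0|k kj].
  have [t [_ st kY]] := maximal_kernel dimX suppX ncX0 regX maxY.
  have [c ->] := (kY _).1 (Y0 j).
  by rewrite mulrCA (st b b0); exact: mulr0.
have [g fK _] := bijY k kj; apply: (can_inj fK).
by rewrite (local_map0 (p k) YX); exact: Y0.
Qed.

Lemma CBP_intro (K : fieldType) (n : nat) (X : subscheme K n)
    (s : nat) (p : 'I_s -> point K n) (dimX : zero_dimensional X)
    (suppX : is_support X p)
    (ncX0 : forall j, ~ p j ('X_ord0 : {mpoly K[n.+1]}))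
    (r : nat) (regX : regularity_index p X r) (d : nat) :
  (forall j (t : local_ring X (p j)), t <> 0 -> in_socle t ->
     ~ forall a, principal t a -> lifts_in_degree d a) ->
  CBP p X d.
Proof.
move=> H j; apply: (natmin_ind (Q := fun m => d + 1 <= m)%N).
  have [Y [m Ym]] := maximal_p_subscheme_exists dimX suppX ncX0 regX j.
  by exists m, Y.
move=> m [Y [_ Ym]]; rewrite addn1 ltnNge; apply/negP => md.
have [t [t0 st lift_t]] := is_mu_rel_lifts dimX suppX ncX0 regX Ym md.
exact: (H j t t0 st lift_t).
Qed.

Theorem proposition4p10 (K : fieldType) (n : nat) (X : subscheme K n)
    (hX : zero_dimensional X)
    (s : nat) (p : 'I_s -> point K n) (hp : is_support X p)
    (hG : locally_gorenstein X p)
    (hX0 : forall j, ~ p j ('X_ord0 : {mpoly K[n.+1]}))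
    (r : nat) (hr : regularity_index p X r)
    (d : nat) (hd : (d < r)%N)
    (sigma : hquot X -> hquot X) (hsigma : homogeneous_trace_map0 sigma) :
  (forall Y : 'I_s -> subscheme K n,
     (forall j, maximal_p_subscheme p X j (Y j)) ->
     (forall j, ~ forall rho : coord_ring X,
        component (@rel_ideal K n X (Y j)) r%:Z rho ->
        component (dedekind_different sigma) (r + d)%:Z
          (coord_to_hquot (x0 X ^+ d * rho))) ->
     CBP p X d) /\
  (HF (dedekind_different sigma) (r + d)%:Z = 0%N -> CBP p X d).
Proof.
have diff j (t : local_ring X (p j)) (f : {mpoly K[n.+1]}) : t <> 0 ->
    (forall a, principal t a -> lifts_in_degree d a) -> f \is r.-homog ->
    (forall b : local_ring X (p j), residue b = 0 -> b * hgerm X (p j) r f = 0) ->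
    (forall k, k != j -> hgerm X (p k) r f = 0) ->
    component (dedekind_different sigma) (r + d)%N%:Z (hq X 0 ('X_ord0 ^+ d * f)).
  move=> t0 lift_t fr mf f0; split.
    exact: (different_of_lift hX hp hX0 hr hsigma t0 lift_t fr mf f0).
  apply/(hdeg_nonneg_hq hX hp hX0 hr _ (leq_addr d r)).
  exists ('X_ord0 ^+ d * f); last reflexivity.
  by rewrite addnC; apply: dhomogM => //; exact: dhomogX0.
split=> [Y maxY nsub|HF0]; apply: (CBP_intro hX hp hX0 hr) => j t t0 st lift_t.
  apply: (nsub j) => rho [[f [Yf rhoE]] /hdeg_coord [f0 f0r f0E]].
  have YX : is_subscheme (Y j) X by case: (maxY j) => -[].
  have Yf0 : Y j f0.
    rewrite -[f0](subrK f); apply: (hidealD (vanishing_idealP (Y j)) _ Yf).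
    by apply: YX; apply/class_eq; rewrite -f0E -rhoE.
  have [mf0 f00] := maximal_p_subscheme_hgerm hX hp hX0 hr (maxY j) f0r Yf0.
  rewrite f0E /x0 -classX -classM coord_to_hquot_class.
  exact: (diff j t).
have [f [fr ft f0]] := hgerms_surj hX hp hX0 hr t.
have mf (b : local_ring X (p j)) : residue b = 0 -> b * hgerm X (p j) r f = 0.
  by rewrite ft; exact: st.
have := dim_eq0 (different_component_subspace hX hp hX0 hr sigma (leq_addr d r))
  (different_component_findim hX hp hX0 hr sigma (leq_addr d r)) HF0
  (diff j t f t0 lift_t fr mf f0).
move/(hq_eq0 hX hp hX0)/(X0X_regular hX hp hX0) => Xf; apply: t0.
by rewrite -ft; exact: (hgerm_ideal (hX0 j) fr Xf).
Qed.
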